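(* There is a universal constant $C'$ such that the following holds. Let $H$ be a separable infinite-dimensional Hilbert space, $E$ a Banach space, and let $\Phi\in\gamma(L^2(\mathbb{R}_+;H),E)$. For all $0<\vartheta<\frac{\pi}{2}$ the family $$\mathscr{T}_\vartheta^\Phi:=\{\sqrt{\lambda}\,\widehat\Phi(\lambda):\ \lambda\in S_\vartheta\},\qquad S_\vartheta=\{z\in\mathbb{C}: z\ne0,\ |\arg z|<\vartheta\},$$ is uniformly $\gamma$-radonifying in $\gamma(H,E)$, and $$\|\mathscr{T}_\vartheta^\Phi\|_{\mathrm{unif}\text{-}\gamma}\le\frac{C'}{\cos\vartheta}\,\|\Phi\|_{\gamma(L^2(\mathbb{R}_+;H),E)}.$$
   Context: Spaces are complex; the argument is taken in $(-\pi,\pi)$ and $\sqrt\lambda$ is the principal branch. Let $(\gamma_k)_{k\ge1}$ be a Gaussian sequence, i.e. independent real-valued standard Gaussian random variables on a probability space $(\Omega,\mathbb{P})$, with expectation $\mathbb{E}$. For a separable Hilbert space $K$, a linear operator $T:K\to E$ is $\gamma$-radonifying if for some (equivalently, every) orthonormal basis $(k_j)_j$ of $K$ the sum $\sum_j\gamma_jTk_j$ converges in $L^2(\Omega;E)$; $\gamma(K,E)$ is the Banach space of such operators, with norm $\|T\|_{\gamma(K,E)}^2=\mathbb{E}\|\sum_j\gamma_jTk_j\|^2$ (independent of the basis). A set $\mathscr{T}$ of bounded linear operators from $H$ to $E$ is uniformly $\gamma$-radonifying if for all orthonormal bases $(h_k)_{k\ge1}$ of $H$ and all sequences $(T_k)_{k\ge1}$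 in $\mathscr{T}$ the sum $\sum_{k\ge1}\gamma_kT_kh_k$ converges in $L^2(\Omega;E)$; then $\|\mathscr{T}\|_{\mathrm{unif}\text{-}\gamma}^2:=\sup\mathbb{E}\|\sum_{k\ge1}\gamma_kT_kh_k\|^2$, the supremum being over all orthonormal bases $(h_k)$ of $H$ and all sequences $(T_k)$ in $\mathscr{T}$. The Laplace transform of $\Phi\in\gamma(L^2(\mathbb{R}_+;H),E)$ is the function $\widehat\Phi:\mathbb{C}_+\to\gamma(H,E)$, $\mathbb{C}_+=\{\mathrm{Re}\,\lambda>0\}$, defined by $\widehat\Phi(\lambda)h:=\Phi(e_\lambda\otimes h)$ for $h\in H$, where $e_\lambda(t)=e^{-\lambda t}$ and $(f\otimes h)(t)=f(t)h$. *)

(* Defs.v *)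
From HB Require Import structures.
From mathcomp Require Import all_boot all_order all_algebra finmap.
From mathcomp Require Import all_classical all_reals all_analysis.
From mathcomp Require Import measurable_realfun.
From mathcomp Require Import complex ring lra.

Set Implicit Arguments.
Unset Strict Implicit.
Unset Printing Implicit Defensive.

Import Order.TTheory GRing.Theory Num.Theory numFieldNormedType.Exports.

Local Open Scope classical_set_scope.
Local Open Scope complex_scope.
Local Open Scope ring_scope.

Section complex_numbers.
Context {R : realType}.
Implicit Types z : R[i].

Definition expC z : R[i] :=
  (expR (complex.Re z) * cos (complex.Im z)) +i*
  (expR (complex.Re z) * sin (complex.Im z)).

(* Principal argument, with values in ]-pi, pi]; irrelevant value at 0. *)
Definition Carg z : R :=
  let a := acos (complex.Re z / complex.Re `|z|) in
  if 0 <= complex.Im z then a else - a.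

Definition sector (theta : R) : set R[i] :=
  [set z | z != 0 /\ `|Carg z| < theta].

End complex_numbers.

(* The norm of a module over R[i] has its values in R[i]; they are real and
   nonnegative, and rnorm reads them in R. *)
Definition rnorm {R : realType} {E : normedModType R[i]} (x : E) : R :=
  complex.Re `|x|.

Section rnorm_lemmas.
Context {R : realType} {E : normedModType R[i]}.
Implicit Types x y : E.

Lemma rnormE x : (rnorm x)%:C = `|x|.
Proof.
exact/RRe_real/ger0_real.
Qed.

Lemma rnorm_ge0 x : 0 <= rnorm x.
Proof. by rewrite -ler0c rnormE. Qed.

Lemma ReM_norm (a : R[i]) : (complex.Re `|a|)%:C = `|a|.
Proof. exact/RRe_real/ger0_real. Qed.

Lemma rnormZ (a : R[i]) x : rnorm (a *: x) = complex.Re `|a| * rnorm x.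
Proof.
by apply: (@complexI R); rewrite rmorphM /= !rnormE ReM_norm normrZ.
Qed.

Lemma ler_rnormD x y : rnorm (x + y) <= rnorm x + rnorm y.
Proof. by rewrite -lecR rmorphD /= !rnormE ler_normD. Qed.

Lemma ler_dist_rnorm x y : `|rnorm x - rnorm y| <= rnorm (x - y).
Proof.
have dB (a b : E) : rnorm a - rnorm b <= rnorm (a - b).
  by have := ler_rnormD (a - b) b; rewrite subrK -lerBlDr.
rewrite ler_norml dB andbT lerNl opprB (le_trans (dB y x))//.
by rewrite -lecR !rnormE distrC.
Qed.

Lemma cvg_rnorm (u : nat -> E) (l : E) :
  u n @[n --> \oo] --> l -> rnorm (u n) @[n --> \oo] --> rnorm l.
Proof.
move=> /cvgrPdist_lt ul; apply/cvgrPdist_lt => e e0.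
have e0C : 0 < e%:C :> R[i] by rewrite ltcR.
near=> n.
apply: (le_lt_trans (ler_dist_rnorm _ _)).
rewrite -ltcR rnormE.
near: n.
exact: ul.
Unshelve. all: by end_near. Qed.

End rnorm_lemmas.

Section strong_measurability.
Context d (T : measurableType d).

Definition simple_fun (Y : Type) (s : T -> Y) :=
  finite_set (range s) /\ forall y, measurable (s @^-1` [set y]).

(* Pointwise limit of measurable functions with finite range. *)
Definition strongly_measurable (R : realType) (E : normedModType R[i])
    (f : T -> E) :=
  exists s : nat -> T -> E, (forall n, simple_fun (s n)) /\
    forall t, s n t @[n --> \oo] --> f t.

Lemma simple_fun_cst (Y : Type) (y : Y) : simple_fun (fun=> y).
Proof.
split.
  by apply: (@sub_finite_set _ _ [set y]); [move=> _ [? _ <-]|].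
by move=> z; rewrite preimage_cst; case: ifP => _; [exact: measurableT|].
Qed.

Lemma simple_fun_comp (Y Z : Type) (F : Y -> Z) (s : T -> Y) :
  simple_fun s -> simple_fun (F \o s).
Proof.
move=> [fs ms]; split.
  have : finite_set (F @` range s) by exact: finite_image.
  by rewrite image_comp.
move=> z.
rewrite (_ : _ @^-1` _ = \bigcup_(y in range s `&` F @^-1` [set z])
  s @^-1` [set y]).
  apply: fin_bigcup_measurable; first exact: finite_setIl.
  by move=> y _; exact: ms.
apply/seteqP; split=> [t /= Fst|t [y [_ /= Fy]] /= -> //].
by exists (s t) => //; split => //; exists t.
Qed.

Lemma simple_fun_pair (Y Z : Type) (s : T -> Y) (s' : T -> Z) :
  simple_fun s -> simple_fun s' -> simple_fun (fun t => (s t, s' t)).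
Proof.
move=> [fs ms] [fs' ms']; split.
  apply: (sub_finite_set _ (finite_setX fs fs')) => _ [t _ <-] /=.
  by split; exists t.
move=> [y z].
rewrite (_ : _ @^-1` _ = s @^-1` [set y] `&` s' @^-1` [set z]).
  exact: measurableI.
by apply/seteqP; split => t /= [-> ->].
Qed.

Lemma simple_fun_measurable (R : realType) (g : T -> R) :
  simple_fun g -> measurable_fun setT g.
Proof.
move=> [fg mg] _ B _; rewrite setTI.
rewrite (_ : _ @^-1` _ = \bigcup_(y in range g `&` B) g @^-1` [set y]).
  apply: fin_bigcup_measurable; first exact: finite_setIl.
  by move=> y _; exact: mg.
apply/seteqP; split=> [t /= Fst|t [y [_ By]] /= -> //].
by exists (g t) => //; split => //; exists t.
Qed.

Section lemmas.
Context {R : realType} {E : normedModType R[i]}.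
Implicit Types f g : T -> E.

Lemma strongly_measurable_cst (x : E) : strongly_measurable (fun=> x).
Proof.
by exists (fun _ _ => x); split=> [n|t]; [exact: simple_fun_cst|exact: cvg_cst].
Qed.

Lemma strongly_measurableDZ (a : R[i]) f g :
  strongly_measurable f -> strongly_measurable g ->
  strongly_measurable (fun t => a *: f t + g t).
Proof.
move=> [s [ss sf]] [s' [ss' sg]].
exists (fun n t => a *: s n t + s' n t); split=> [n|t].
  exact: (simple_fun_comp (fun p => a *: p.1 + p.2)
    (simple_fun_pair (ss n) (ss' n))).
by apply: cvgD => //; apply: cvgZr.
Qed.

Lemma strongly_measurable_rnorm f : strongly_measurable f ->
  measurable_fun setT (fun t => rnorm (f t)).
Proof.
move=> [s [ss sf]].
apply: (@measurable_fun_cvg _ _ _ _ (fun n t => rnorm (s n t))).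
  by move=> n; apply: simple_fun_measurable; exact: (simple_fun_comp _ (ss n)).
by move=> t _; exact: cvg_rnorm.
Qed.

End lemmas.

End strong_measurability.

Section square_integrable.
Context d (T : measurableType d) (R : realType).
Variable mu : {measure set T -> \bar R}.
Variable D : set T.
Variable E : normedModType R[i].
Implicit Types f g : T -> E.

Definition int_sqnorm f : \bar R := (\int[mu]_(t in D) (rnorm (f t) ^+ 2)%:E)%E.

Definition square_integrable f :=
  strongly_measurable f /\ (int_sqnorm f < +oo)%E.

Hypothesis mD : measurable D.

Lemma square_integrable_submod_closed :
  submod_closed [pred f : T -> E | `[< square_integrable f >]].
Proof.
have mf f : strongly_measurable f ->
    measurable_fun D (fun t => (rnorm (f t) ^+ 2)%:E).
  move=> sf; apply/measurable_EFinP/measurable_funX.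
  by apply: measurable_funTS; exact: strongly_measurable_rnorm.
split.
  apply/asboolP; split; first exact: strongly_measurable_cst.
  rewrite /int_sqnorm integral0_eq// => t _.
  by rewrite /rnorm normr0 expr0n.
move=> a f g /asboolP[sf ff] /asboolP[sg fg]; apply/asboolP; split.
  exact: strongly_measurableDZ.
pose c : R := 2 * complex.Re `|a| ^+ 2.
have c0 : 0 <= c by rewrite mulr_ge0 ?sqr_ge0.
have F0 (h : T -> E) t : D t -> (0 <= (rnorm (h t) ^+ 2)%:E)%E.
  by move=> _; rewrite lee_fin sqr_ge0.
apply: (@le_lt_trans _ _ (c%:E * int_sqnorm f + 2%:E * int_sqnorm g)%E).
  have intZ (h : T -> E) (k : R) : strongly_measurable h -> 0 <= k ->
      (k%:E * int_sqnorm h = \int[mu]_(t in D) (k%:E * (rnorm (h t) ^+ 2)%:E))%E.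
    by move=> sh k0; rewrite ge0_integralZl_EFin//; [exact: F0|exact: mf].
  rewrite !intZ// /int_sqnorm.
  rewrite -ge0_integralD//; last 4 first.
  - by move=> t Dt; rewrite mule_ge0 ?lee_fin ?sqr_ge0.
  - by apply: measurable_funeM; exact: mf.
  - by move=> t Dt; rewrite mule_ge0 ?lee_fin ?sqr_ge0.
  - by apply: measurable_funeM; exact: mf.
  apply: ge0_le_integral => //.
  - by move=> t Dt; exact: F0.
  - by apply: mf; exact: strongly_measurableDZ.
  - apply: emeasurable_funD; apply: measurable_funeM; exact: mf.
  move=> t _; rewrite -!EFinM -EFinD lee_fin.
  have := ler_rnormD (a *: f t) (g t); rewrite rnormZ => le1.
  have r0 : 0 <= complex.Re `|a| by rewrite normc_def /= sqrtr_ge0.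
  have sqr_le (u v w r : R) : 0 <= u -> 0 <= v -> 0 <= w -> 0 <= r ->
      u <= r * v + w -> u ^+ 2 <= 2 * r ^+ 2 * v ^+ 2 + 2 * w ^+ 2.
    move=> u0 v0 w0 r0' uvw; have vr0 : 0 <= r * v by exact: mulr_ge0.
    rewrite -subr_ge0 [leRHS](_ : _ =
      (r * v - w) ^+ 2 + ((r * v + w) ^+ 2 - u ^+ 2)); last by ring.
    apply: addr_ge0; first exact: sqr_ge0.
    by rewrite subr_ge0 ler_sqr ?nnegrE// addr_ge0.
  exact: (sqr_le _ _ _ _ (rnorm_ge0 _) (rnorm_ge0 _) (rnorm_ge0 _) r0 le1).
by rewrite lte_add_pinfty// lte_mul_pinfty// ?lee_fin.
Qed.

End square_integrable.

Section L2_space.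
Context d (T : measurableType d) (R : realType).
Variable mu : {measure set T -> \bar R}.
Variables (D : set T) (mD : measurable D).
Variable E : normedModType R[i].

Definition L2pred of measurable D : {pred T -> E} :=
  [pred f | `[< square_integrable mu D f >]].

HB.instance Definition _ := GRing.isSubmodClosed.Build _ _ (L2pred mD)
  (square_integrable_submod_closed mu E mD).

(* Functions, not classes modulo a.e. equality: maps out of the quotient space
   L^2(D; E) are the maps on L2fun that respect equality a.e. on D, which every
   linear map bounded for the L^2-seminorm does. *)
Record L2fun := MkL2fun { L2val :> T -> E ; _ : L2val \in L2pred mD }.

HB.instance Definition _ := [isSub for L2val].
HB.instance Definition _ := [Choice of L2fun by <:].
HB.instance Definition _ := [SubChoice_isSubLmodule of L2fun by <:].

End L2_space.

Definition L2dot d (T : measurableType d) (R : realType)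
    (mu : {measure set T -> \bar R}) (D : set T) (mD : measurable D)
    (H : normedModType R[i]) (dot : H -> H -> R[i])
    (f g : L2fun mu mD H) : R[i] :=
  (\int[mu]_(t in D) complex.Re (dot (f t) (g t))) +i*
  (\int[mu]_(t in D) complex.Im (dot (f t) (g t))).

Section gaussian_sequences.
Context d (Omega : measurableType d) (R : realType) (P : probability Omega R).

Definition mutually_independent (X : nat -> {RV P >-> R}) :=
  forall (J : {fset nat}) (A : nat -> set R),
    (forall j, j \in J -> measurable (A j)) ->
    P (\bigcap_(j in [set` J]) (X j @^-1` A j)) =
    (\prod_(j <- J) P (X j @^-1` A j))%E.

Definition gaussian_sequence (gam : nat -> {RV P >-> R}) :=
  (forall n (A : set R), measurable A ->
    distribution P (gam n) A = normal_prob 0 1 A) /\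
  mutually_independent gam.

Variable gam : nat -> {RV P >-> R}.
Context {E : normedModType R[i]}.
Implicit Types x : nat -> E.

Definition gauss_psum x (n : nat) (w : Omega) : E :=
  \sum_(k < n) (gam k w)%:C *: x k.

Definition gauss_sum_to x (X : Omega -> E) :=
  square_integrable P setT X /\
  (int_sqnorm P setT (fun w => gauss_psum x n w - X w)) @[n --> \oo] --> 0%E.

Definition gauss_cvg x := exists X, gauss_sum_to x X.

(* The sum of the series when it converges; well-defined up to a.e. equality. *)
Definition gauss_sum x : Omega -> E := xget (fun=> 0) [set X | gauss_sum_to x X].

Definition gauss_sqnorm x : \bar R := int_sqnorm P setT (gauss_sum x).

End gaussian_sequences.

Section gamma_radonifying.
Context d (Omega : measurableType d) (R : realType) (P : probability Omega R).
Variable gam : nat -> {RV P >-> R}.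
(* K with the form dot is either a Hilbert space or a space L2fun with L2dot. *)
Variables (K : lmodType R[i]) (dot : K -> K -> R[i]).
Context {E : normedModType R[i]}.
Implicit Types (k : nat -> K) (S : K -> E) (TT : set (K -> E)).

Definition dot_norm (x : K) : R := Num.sqrt (complex.Re (dot x x)).

Definition orthonormal_basis k :=
  (forall i j, dot (k i) (k j) = (i == j)%:R) /\
  forall x, dot_norm (x - \sum_(j < n) dot x (k j) *: k j) @[n --> \oo] --> 0.

Definition bounded_linear S :=
  linear S /\ exists M : R, forall x, rnorm (S x) <= M * dot_norm x.

Definition gamma_radonifying S :=
  bounded_linear S /\
  exists k, orthonormal_basis k /\ gauss_cvg gam (S \o k).

(* The gamma-norm computed in the basis k. The basis is kept as an argument:
   with real Gaussian variables and complex scalars, changing the basis may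
   change the value by a bounded factor. *)
Definition gamma_norm k S : \bar R := sqrte (gauss_sqnorm gam (S \o k)).

Definition unif_gamma_radonifying TT :=
  (forall S, TT S -> bounded_linear S) /\
  forall (k : nat -> K) (S : nat -> K -> E),
    orthonormal_basis k -> (forall n, TT (S n)) ->
    gauss_cvg gam (fun n => S n (k n)).

Definition unif_gamma_norm TT : \bar R :=
  sqrte (ereal_sup [set r | exists (k : nat -> K) (S : nat -> K -> E),
    [/\ orthonormal_basis k, forall n, TT (S n) &
       r = gauss_sqnorm gam (fun n => S n (k n))]]).

End gamma_radonifying.

Section separable_infinite_dimensional.
Context {R : realType}.

Definition separable (X : topologicalType) :=
  exists A : set X, countable A /\ dense A.

Definition infinite_dimensional (V : lmodType R[i]) :=
  forall (n : nat) (v : 'I_n -> V), exists x : V,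
    forall c : 'I_n -> R[i], x != \sum_(i < n) c i *: v i.

End separable_infinite_dimensional.

Definition L2Rplus {R : realType} (H : normedModType R[i]) :=
  L2fun (@lebesgue_measure R) (measurable_itv `[0 : R, +oo[) H.

Section laplace_transform.
Context {R : realType} {H : normedModType R[i]}.

Definition exp_fun (lambda : R[i]) (h : H) (t : R) : H :=
  expC (- (lambda * t%:C)) *: h.

(* The default value 0 of insubd is not used when Re lambda > 0, see
   exp_tensorE. *)
Definition exp_tensor (lambda : R[i]) (h : H) : L2Rplus H :=
  insubd (0 : L2Rplus H) (exp_fun lambda h).

Import HBSimple.

Lemma strongly_measurable_scale d (T : measurableType d) (r : T -> R) (h : H) :
  measurable_fun setT r -> strongly_measurable (fun t => (r t)%:C *: h).
Proof.
move=> mr.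
have mEr : measurable_fun setT (EFin \o r) by exact/measurable_EFinP.
have [g gr] := approximation_sfun measurableT mEr.
exists (fun n t => (g n t)%:C *: h); split=> [n|t].
  apply: (@simple_fun_comp _ _ _ _ (fun a : R => a%:C *: h) (g n)).
  by split=> [|y]; [exact: fimfunP|exact: measurable_funPTI].
have /fine_cvgP[_ /= grt] := gr t I.
have {}grt : g n t * rnorm h @[n --> \oo] --> r t * rnorm h.
  exact: cvgMr_tmp.
apply/cvgrPdist_lt => e e0.
have eE : (complex.Re e)%:C = e by exact/RRe_real/gtr0_real.
have e0' : 0 < complex.Re e by rewrite -ltcR eE.
move/cvgrPdist_lt : grt => /(_ _ e0') grt.
near=> n.
rewrite -scalerBl -rnormE rnormZ -eE ltcR.
rewrite -rmorphB normc_def /= expr0n addr0 sqrtr_sqr.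
rewrite -[rnorm h]ger0_norm ?rnorm_ge0// -normrM mulrBl.
by near: n.
Unshelve. all: by end_near. Qed.

Lemma exp_fun_square_integrable (lambda : R[i]) (h : H) :
  0 < complex.Re lambda ->
  square_integrable (@lebesgue_measure R) `[0, +oo[ (exp_fun lambda h).
Proof.
case: lambda => a b /= a0.
have expE t : - ((a +i* b) * t%:C) = (- (a * t)) +i* (- (b * t)).
  by apply/eqP; rewrite eq_complex /= !mulr0 subr0 add0r !eqxx.
have mlin (c : R) : measurable_fun setT (fun t : R => - (c * t)).
  by apply: measurable_funN; apply: measurable_funM.
have mexp : measurable_fun setT (fun t : R => expR (- (a * t))).
  exact: (measurableT_comp (@measurable_expR R) (mlin a)).
split.
  have -> : exp_fun (a +i* b) h = fun t : R =>
      'i *: ((expR (- (a * t)) * sin (- (b * t)))%:C *: h) +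
      (expR (- (a * t)) * cos (- (b * t)))%:C *: h.
    apply/funext => t; rewrite /exp_fun expE scalerA -scalerDl; congr (_ *: _).
    by apply/eqP; rewrite eq_complex /=; apply/andP; split; apply/eqP; ring.
  apply: strongly_measurableDZ; apply: strongly_measurable_scale;
    apply: measurable_funM => //.
  - apply: (@measurableT_comp _ _ _ _ _ _ sin _ _ _ (mlin b)).
    by apply: continuous_measurable_fun; exact: continuous_sin.
  - apply: (@measurableT_comp _ _ _ _ _ _ cos _ _ _ (mlin b)).
    by apply: continuous_measurable_fun; exact: continuous_cos.
have normE t : rnorm (exp_fun (a +i* b) h t) = expR (- (a * t)) * rnorm h.
  rewrite /exp_fun rnormZ expE; congr (_ * _).
  rewrite normc_def /= !exprMn -mulrDr cos2Dsin2 mulr1 sqrtr_sqr.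
  by rewrite ger0_norm ?expR_ge0.
have a20 : 0 < 2 * a by rewrite mulr_gt0.
pose k := rnorm h ^+ 2 / (2 * a).
have k0 : 0 <= k by rewrite divr_ge0 ?sqr_ge0 ?ltW.
rewrite /int_sqnorm.
have -> : (\int[lebesgue_measure]_(t in `[0%R, +oo[)
      (rnorm (exp_fun (a +i* b) h t) ^+ 2)%:E =
    \int[lebesgue_measure]_(t in `[0%R, +oo[)
      (k%:E * (exponential_pdf (2 * a) t)%:E))%E.
  apply: eq_integral => t; rewrite inE /= in_itv /= andbT => t0.
  rewrite normE exponential_pdfE// -EFinM; congr (_%:E).
  rewrite exprMn expr2 -expRD /k (_ : - (a * t) + _ = - (2 * a) * t); last ring.
  by field; rewrite gt_eqF.
have mpdf : measurable_fun setT (EFin \o exponential_pdf (2 * a)).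
  by apply/measurable_EFinP; exact: measurable_exponential_pdf.
have pdf0 t : (0 <= (exponential_pdf (2 * a) t)%:E)%E.
  by rewrite lee_fin exponential_pdf_ge0// ltW.
rewrite ge0_integralZl_EFin//; last exact: measurable_funTS.
apply: (@le_lt_trans _ _ (k%:E * 1)%E); last by rewrite mule1 ltry.
apply: lee_wpmul2l; first by rewrite lee_fin.
rewrite -(integral_exponential_pdf a20).
exact: ge0_subset_integral.
Qed.

Lemma exp_tensorE (lambda : R[i]) (h : H) : 0 < complex.Re lambda ->
  exp_tensor lambda h = exp_fun lambda h :> (R -> H).
Proof.
move=> l0; rewrite /exp_tensor -[LHS]/(val _) insubdK//.
exact/asboolP/exp_fun_square_integrable.
Qed.

Definition laplace (E : Type) (Phi : L2Rplus H -> E) (lambda : R[i]) (h : H) : E :=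
  Phi (exp_tensor lambda h).

End laplace_transform.

Definition laplace_family {R : realType} {H E : normedModType R[i]}
    (Phi : L2Rplus H -> E) (theta : R) : set (H -> E) :=
  [set S | exists2 lambda, sector theta lambda &
     S = (fun h => sqrtc lambda *: laplace Phi lambda h)].

(* Main.v *)
Require Import Defs.
From HB Require Import structures.
From mathcomp Require Import all_boot all_order all_algebra finmap.
From mathcomp Require Import all_classical all_reals all_analysis.
From mathcomp Require Import measurable_realfun complex ring lra.

Set Implicit Arguments.
Unset Strict Implicit.
Unset Printing Implicit Defensive.

Import Order.TTheory GRing.Theory Num.Theory numFieldNormedType.Exports.

Local Open Scope classical_set_scope.
Local Open Scope complex_scope.
Local Open Scope ring_scope.

(** Let h be an orthonormal basis of H and let the lambda_n lie in the sector of
    angle theta. The vectors f_n = sqrt(lambda_n) e_{lambda_n} (x) h_n of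
    L^2(R_+; H) are pairwise orthogonal because the h_n are, and
    |f_n|^2 = |lambda_n| / (2 Re lambda_n) is at most c^2 = 1 / (2 cos theta).
    Hence |sum t_n f_n| <= c |t| for all real t, and the sums to be controlled
    are the Gaussian sums of the Phi f_n. The theorem is thus an instance of the
    ideal property of gamma-radonifying operators: if the Gaussian series of
    Phi k_j converges for one orthonormal basis k, that of Phi f_n converges and
    its norm is at most a universal multiple of c times that of the first one
    ([gauss_cvg_ideal], [gauss_sqnorm_ideal]). With f another orthonormal basis
    and c = 1, the same statement lets every basis of L^2(R_+; H) serve to
    compute the norm of Phi.

    The ideal property comes from an inequality in finite dimension: for a real
    matrix B that is a contraction,
      E |sum_n gamma_n (B x)_n|^2 <= E |sum_l gamma_l x_l|^2
    ([energy_contraction]). A Cholesky factorization 1 - B B^T = C C^T completes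
    B to a matrix [B C] with orthonormal rows, which Givens rotations of the
    columns turn into a diagonal matrix of signs. These rotations and signs do
    not change the energy E |sum_l gamma_l x_l|^2, since the law of a Gaussian
    vector is invariant under them, and dropping terms decreases it by symmetry
    ([energy_le]). The rotation invariance is reduced to the plane, where the
    Gaussian density is radial and a rotation is the product of three shears;
    these preserve the Lebesgue measure by translation invariance and Fubini.
    The scalars being complex and the Gaussian variables real, a complex matrix
    is cut into its real and imaginary parts, which costs the constant factor
    ([energy_complex_contraction]).

    To pass to infinite sums, expand f_n in the basis k. By Fatou it is enough
    to bound the energies of the projections onto k_0, ..., k_{M-1}, uniformly
    in M. For a late window of indices n, the first J coordinates of the f_n are
    small in the Hilbert-Schmidt sense and the other ones only see the tail of
    the series of Phi k_j; so the partial sums are Cauchy, and their limit exists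
    by the completeness of L^2 ([L2_complete]). *)

(** * Shears and rotations of the Gaussian plane *)

Section translation.
Context {R : realType}.
Local Notation mu := (@lebesgue_measure R).

(** Translating a half-open interval keeps its length, and these intervals
    determine the measure. *)
Lemma lebesgue_measureDr (a : R) (A : set R) : measurable A ->
  pushforward mu ((fun x => x + a) : _ -> measurableTypeR R) A = mu A.
Proof.
have mD : measurable_fun setT (fun x : R => x + a) by exact: measurable_funD.
move=> mA; apply/esym.
apply: lebesgue_measure_unique => //= _ [[b c]] _ <-.
rewrite /pushforward.
rewrite (_ : _ @^-1` _ = `]b - a, c - a]%classic).
rewrite !lebesgue_measure_itv/= !lte_fin ltrD2r.
by case: ifP => // _; rewrite -!EFinD; congr (_%:E); ring.
by apply/seteqP; split=> x /=; rewrite !in_itv/= ltrBlDr lerBrDr.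
Qed.

Lemma ge0_integral_lebesgueDr (f : R -> \bar R) (a : R) :
  measurable_fun setT f -> (forall x, 0 <= f x)%E ->
  (\int[mu]_x f (x + a)%R = \int[mu]_x f x)%E.
Proof.
move=> mf f0.
have mD : measurable_fun setT ((fun x => x + a) : measurableTypeR R -> measurableTypeR R).
  exact: measurable_funD.
rewrite -(@ge0_integral_pushforward _ _ _ _ _ _ mD mu setT f)//.
apply: eq_measure_integral => A mA _; exact: lebesgue_measureDr.
Qed.

End translation.

Section planar_gaussian.
Context {R : realType}.
Local Notation mR := (measurableTypeR R).
Local Notation mu := (@lebesgue_measure R).

(** For fixed z.2 the shear is a translation of z.1. *)
Lemma ge0_integral_shear1 (f : mR * mR -> \bar R) (a : R) :
  measurable_fun setT f -> (forall z, 0 <= f z)%E ->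
  (\int[mu \x mu]_z f (z.1 + a * z.2, z.2)%R = \int[mu \x mu]_z f z)%E.
Proof.
move=> mf f0.
have ms : measurable_fun setT
    ((fun z => (z.1 + a * z.2, z.2)) : mR * mR -> mR * mR).
  apply: measurable_fun_pair => //; apply: measurable_funD => //.
  exact: measurable_funM.
rewrite fubini_tonelli2//; last exact: measurableT_comp mf ms.
rewrite [RHS]fubini_tonelli2//; apply: eq_integral => y _.
rewrite /fubini_G /=.
rewrite (@ge0_integral_lebesgueDr _ (fun x => f (x, y)) (a * y))//.
exact: measurableT_comp mf (measurable_pair2 y).
Qed.

Lemma ge0_integral_shear2 (f : mR * mR -> \bar R) (a : R) :
  measurable_fun setT f -> (forall z, 0 <= f z)%E ->
  (\int[mu \x mu]_z f (z.1, z.2 + a * z.1)%R = \int[mu \x mu]_z f z)%E.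
Proof.
move=> mf f0.
have ms : measurable_fun setT
    ((fun z => (z.1, z.2 + a * z.1)) : mR * mR -> mR * mR).
  apply: measurable_fun_pair => //; apply: measurable_funD => //.
  exact: measurable_funM.
rewrite fubini_tonelli1//; last exact: measurableT_comp mf ms.
rewrite [RHS]fubini_tonelli1//; apply: eq_integral => x _.
rewrite /fubini_F /=.
rewrite (@ge0_integral_lebesgueDr _ (fun y => f (x, y)) (a * x))//.
exact: measurableT_comp mf (measurable_pair1 x).
Qed.

Definition rotation (c s : R) (z : mR * mR) : mR * mR :=
  (c * z.1 - s * z.2, s * z.1 + c * z.2).

Lemma measurable_rotation c s : measurable_fun setT (rotation c s).
Proof.
apply: measurable_fun_pair => /=.
  by apply: measurable_funB; exact: measurable_funM.
by apply: measurable_funD; exact: measurable_funM.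
Qed.

(** With a = - tan (phi / 2) = - s / (1 + c), the rotation of angle phi is the
    composite of the shear of ratio a, the transposed shear of ratio s and the
    shear of ratio a again. The half turn, where 1 + c = 0, is excluded. *)
Lemma ge0_integral_rotation (f : mR * mR -> \bar R) (c s : R) :
  c ^+ 2 + s ^+ 2 = 1 -> 1 + c != 0 ->
  measurable_fun setT f -> (forall z, 0 <= f z)%E ->
  (\int[mu \x mu]_z f (rotation c s z) = \int[mu \x mu]_z f z)%E.
Proof.
move=> cs1 c1 mf f0.
pose a := - s / (1 + c).
have ms1 : measurable_fun setT
    ((fun z => (z.1 + a * z.2, z.2)) : mR * mR -> mR * mR).
  apply: measurable_fun_pair => //; apply: measurable_funD => //.
  exact: measurable_funM.
have ms2 : measurable_fun setT
    ((fun z => (z.1, z.2 + s * z.1)) : mR * mR -> mR * mR).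
  apply: measurable_fun_pair => //; apply: measurable_funD => //.
  exact: measurable_funM.
rewrite -(@ge0_integral_shear1 f a)//.
rewrite -(@ge0_integral_shear2 (fun z => f (z.1 + a * z.2, z.2)) s)//; last first.
  exact: measurableT_comp mf ms1.
rewrite -(@ge0_integral_shear1
  (fun z => f (z.1 + a * (z.2 + s * z.1), z.2 + s * z.1)) a)//; last first.
  exact: measurableT_comp (measurableT_comp mf ms1) ms2.
have ac : a * (1 + c) = - s by rewrite /a mulfVK.
have as1 : 1 + a * s = c.
  apply: (mulIf c1); transitivity (1 + c + a * (1 + c) * s); first by ring.
  by rewrite ac; move: cs1; lra.
apply: eq_integral => -[x y] _; rewrite /rotation /=; congr (f (_, _)).
  transitivity ((1 + a * s) * x + a * (1 + (1 + a * s)) * y); last by ring.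
  by rewrite as1 ac mulNr.
transitivity (s * x + (1 + a * s) * y); last by ring.
by rewrite as1.
Qed.

Local Notation phi := (@normal_pdf R 0 1).

Definition gauss2_pdf (z : mR * mR) : R := phi z.1 * phi z.2.

Lemma gauss2_pdf_ge0 z : 0 <= gauss2_pdf z.
Proof. by rewrite mulr_ge0// normal_pdf_ge0. Qed.

Lemma measurable_gauss2_pdf : measurable_fun setT gauss2_pdf.
Proof.
by apply: measurable_funM; apply: measurableT_comp => //;
  exact: measurable_normal_pdf.
Qed.

Lemma gauss2_pdf_rotation c s z : c ^+ 2 + s ^+ 2 = 1 ->
  gauss2_pdf (rotation c s z) = gauss2_pdf z.
Proof.
move=> cs1; rewrite /gauss2_pdf !normal_pdfE ?oner_eq0// /normal_fun.
rewrite mulrACA [RHS]mulrACA -!expRD; congr (_ * expR _).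
rewrite -!mulrDl !subr0; congr (_ / _) => /=.
transitivity (- ((c ^+ 2 + s ^+ 2) * (z.1 ^+ 2 + z.2 ^+ 2))); first by ring.
by rewrite cs1; ring.
Qed.

(** The law of a pair of independent standard Gaussian variables. *)
Definition gauss2 (D : set (mR * mR)) : \bar R :=
  (\int[mu \x mu]_(z in D) (gauss2_pdf z)%:E)%E.

Let gauss2_0 : gauss2 set0 = 0%E.
Proof. by rewrite /gauss2 integral_set0. Qed.

Let gauss2_ge0 D : (0 <= gauss2 D)%E.
Proof. by apply: integral_ge0 => z _; rewrite lee_fin gauss2_pdf_ge0. Qed.

Let gauss2_sigma_additive : semi_sigma_additive gauss2.
Proof.
move=> /= F mF tF mUF; rewrite /gauss2; apply: cvg_toP.
  apply: ereal_nondecreasing_is_cvgn => m n mn.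
  apply: lee_sum_nneg_natr => // k _ _.
  by apply: integral_ge0 => /= x Fkx; rewrite lee_fin gauss2_pdf_ge0.
rewrite ge0_integral_bigcup//=.
- apply: measurable_funTS; apply: measurableT_comp => //.
  exact: measurable_gauss2_pdf.
- by move=> x _; rewrite lee_fin gauss2_pdf_ge0.
Qed.

HB.instance Definition _ := isMeasure.Build _ _ _ gauss2
  gauss2_0 gauss2_ge0 gauss2_sigma_additive.

Lemma gauss2E (D : set (mR * mR)) : measurable D ->
  (gauss2 D = \int[mu \x mu]_z ((\1_D z * gauss2_pdf z)%:E))%E.
Proof.
move=> mD; rewrite /gauss2 integral_mkcond; apply: eq_integral => z _.
by rewrite patchE indicE; case: ifPn => zD; rewrite ?mul1r ?mul0r.
Qed.

Lemma gauss2_setX (A B : set R) : measurable A -> measurable B ->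
  gauss2 (A `*` B) = (normal_prob 0 1 A * normal_prob 0 1 B)%E.
Proof.
move=> mA mB; rewrite gauss2E; last exact: measurableX.
have mphi : measurable_fun setT (EFin \o phi).
  by apply/measurable_EFinP; exact: measurable_normal_pdf.
have m1 (C : set R) : measurable C ->
    measurable_fun setT (fun x : mR => (\1_C x * phi x)%:E).
  move=> mC; apply/measurable_EFinP/measurable_funM; last exact: measurable_normal_pdf.
  exact: measurable_indic.
have nE (C : set R) : measurable C ->
    (\int[mu]_x ((\1_C x * phi x)%:E) = normal_prob 0 1 C)%E.
  move=> mC; rewrite /normal_prob [RHS]integral_mkcond; apply: eq_integral => x _.
  by rewrite patchE indicE; case: ifPn => zD; rewrite ?mul1r ?mul0r.
have ge0 (C : set R) x : 0 <= \1_C x * phi x.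
  by rewrite mulr_ge0// normal_pdf_ge0.
have E (x y : R) : \1_(A `*` B) (x, y) * gauss2_pdf (x, y) =
    (\1_A x * phi x) * (\1_B y * phi y).
  by rewrite /gauss2_pdf !indicE in_setX /= -mulnb natrM; ring.
rewrite fubini_tonelli1//; last 2 first.
- apply/measurable_EFinP/measurable_funM; last exact: measurable_gauss2_pdf.
  by apply: measurable_indic; exact: measurableX.
- by move=> z; rewrite lee_fin mulr_ge0// gauss2_pdf_ge0.
transitivity (\int[mu]_x ((\1_A x * phi x)%:E * normal_prob 0 1 B))%E.
  apply: eq_integral => x _; rewrite /fubini_F -nE//.
  rewrite -ge0_integralZl_EFin//.
  - by apply: eq_integral => y _; rewrite E EFinM.
  - by move=> y _; rewrite lee_fin ge0.
  - exact: m1.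
rewrite ge0_integralZr//; first by rewrite nE.
- exact: m1.
- by move=> x _; rewrite lee_fin.
Qed.

Lemma gauss2_rotation c s (D : set (mR * mR)) :
  c ^+ 2 + s ^+ 2 = 1 -> 1 + c != 0 -> measurable D ->
  gauss2 (rotation c s @^-1` D) = gauss2 D.
Proof.
move=> cs1 c1 mD; rewrite !gauss2E//; last first.
  by rewrite -[X in measurable X]setTI; exact: measurable_rotation.
rewrite -(@ge0_integral_rotation (fun z => (\1_D z * gauss2_pdf z)%:E) c s)//.
- by apply: eq_integral => z _; rewrite gauss2_pdf_rotation.
- apply/measurable_EFinP/measurable_funM; last exact: measurable_gauss2_pdf.
  exact: measurable_indic.
- by move=> z; rewrite lee_fin mulr_ge0// gauss2_pdf_ge0.
Qed.

End planar_gaussian.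

(** * Gaussian vectors *)

Section gaussian_vector.
Context d (Omega : measurableType d) (R : realType) (P : probability Omega R).
Variable m : nat.
Implicit Types X Y : 'I_m -> Omega -> R.
Local Notation N01 := (@normal_prob R 0 1).

(** The joint law is specified on rectangles, as independence is. *)
Definition gaussian_vector X :=
  (forall k, measurable_fun setT (X k)) /\
  forall A : 'I_m -> set R, (forall k, measurable (A k)) ->
    P (\bigcap_k (X k @^-1` A k)) = (\prod_k N01 (A k))%E.

(** Rectangles form a pi-system generating the sigma-algebra of tuples, so two
    Gaussian vectors have the same law. *)
Lemma gaussian_vector_law X Y (f : m.-tuple R -> \bar R) :
  gaussian_vector X -> gaussian_vector Y ->
  measurable_fun setT f -> (forall t, 0 <= f t)%E ->
  (\int[P]_w f [tuple X k w | k < m] = \int[P]_w f [tuple Y k w | k < m])%E.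
Proof.
move=> [mX XA] [mY YA] mf f0.
have mT (Z : 'I_m -> Omega -> R) : (forall k, measurable_fun setT (Z k)) ->
    measurable_fun setT (fun w => [tuple Z k w | k < m]).
  move=> mZ; apply/measurable_fun_tnthP => k.
  rewrite (_ : _ \o _ = Z k)//; apply/funext => w /=.
  by rewrite tnth_mktuple.
pose mX' := measure_function_pushforward__canonical__measure_function_Measure P (mT X mX).
pose mY' := measure_function_pushforward__canonical__measure_function_Measure P (mT Y mY).
suff E (D : set (m.-tuple R)) : measurable D -> mX' D = mY' D.
  have := @ge0_integral_pushforward _ _ _ _ _ _ (mT X mX) P setT f.
  have := @ge0_integral_pushforward _ _ _ _ _ _ (mT Y mY) P setT f.
  rewrite !preimage_setT => <-// <-//.
  apply: (@eq_measure_integral _ _ _ setT mY' mX') => D mD _; exact: E.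
move=> mD.
pose G : set (set (m.-tuple R)) := [set B | exists A : 'I_m -> set R,
  (forall k, measurable (A k)) /\ B = \bigcap_k ((fun t => tnth t k) @^-1` A k)].
apply: (@measure_unique _ _ _ G (fun=> setT) _ _ _ _ mX' mY') => //.
- apply/seteqP; split.
    apply: smallest_sub; first exact: smallest_sigma_algebra.
    rewrite -bigcup_seq; apply: bigcup_sub => i _ B [A mA <-].
    apply: sub_sigma_algebra; exists (fun k => if k == i then A else setT).
    split; first by move=> k; case: ifP.
    apply/seteqP; split=> [t [_ /= At] k _ /=|t /(_ i I) /=].
      by case: eqP => // ->.
    by rewrite eqxx.
  apply: smallest_sub; first exact: sigma_algebra_measurable.
  move=> B [A [mA ->]].
  apply: fin_bigcap_measurable => // k _.
  rewrite -[X in measurable X]setTI; exact: measurable_tnth.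
- move=> B C [A [mA ->]] [A' [mA' ->]].
  exists (fun k => A k `&` A' k); split; first by move=> k; exact: measurableI.
  by rewrite -bigcapI; apply: eq_bigcapr => k _; rewrite preimage_setI.
- move=> _; exists (fun=> setT); split=> //.
  by rewrite bigcapT.
- by rewrite bigcup_const.
- move=> B [A [mA ->]].
  rewrite /mX' /mY' /= /pushforward !preimage_bigcap.
  have E (Z : 'I_m -> Omega -> R) : \bigcap_i ((fun w => [tuple Z k w | k < m]) @^-1`
      ((fun t => tnth t i) @^-1` A i)) = \bigcap_i (Z i @^-1` A i).
    by apply: eq_bigcapr => i _; apply/seteqP; split=> w /=; rewrite tnth_mktuple.
  by rewrite !E XA// YA.
- by move=> k; rewrite /mX' /= /pushforward preimage_setT probability_setT ltry.
Qed.

Definition givens_rv (i j : 'I_m) (c s : R) X : 'I_m -> Omega -> R :=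
  fun k w => if k == i then c * X i w - s * X j w
             else if k == j then s * X i w + c * X j w else X k w.

(** Freeze the other coordinates in the given sets: the law of the pair (X i, X j)
    restricted to that event is a multiple of the planar Gaussian measure, which
    the rotation preserves. *)
Lemma gaussian_vector_givens (i j : 'I_m) (c s : R) X : i != j ->
  c ^+ 2 + s ^+ 2 = 1 -> 1 + c != 0 ->
  gaussian_vector X -> gaussian_vector (givens_rv i j c s X).
Proof.
move=> ij cs1 c1 [mX XA]; split.
  move=> k; rewrite /givens_rv; case: eqP => _; last case: eqP => _ //.
    by apply: measurable_funB; exact: measurable_funM.
  by apply: measurable_funD; exact: measurable_funM.
move=> A mA.
pose S := \bigcap_(k in [set k | k != i /\ k != j]) (X k @^-1` A k).
have mS : measurable S.
  apply: fin_bigcap_measurable => [|k _]; first exact: finite_finset.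
  by rewrite -[X in measurable X]setTI; exact: mX.
pose pr : Omega -> measurableTypeR R * measurableTypeR R := fun w => (X i w, X j w).
have mXR k : measurable_fun setT (X k : Omega -> measurableTypeR R) by exact: mX.
have mpr : measurable_fun setT pr := measurable_fun_pair (mXR i) (mXR j).
have prodE (B : 'I_m -> set R) : (\prod_k N01 (B k) = N01 (B i) * N01 (B j) *
    \prod_(k | (k != i) && (k != j)) N01 (B k))%E.
  by rewrite (bigD1 i)//= (bigD1 j) 1?eq_sym//= muleA.
pose c0 := (\prod_(k | (k != i) && (k != j)) N01 (A k))%E.
have c00 : (0 <= c0)%E by apply: prode_ge0 => k _; exact: measure_ge0.
have c0f : c0 \is a fin_num.
  apply: prode_fin_num => k _; apply: fin_num_measure; exact: mA.
have finec0 : 0 <= fine c0 by rewrite fine_ge0.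
have Qrect (B C : set R) : measurable B -> measurable C ->
    P (pr @^-1` (B `*` C) `&` S) = (c0 * (N01 B * N01 C))%E.
  move=> mB mC.
  pose A' k := if k == i then B else if k == j then C else A k.
  have -> : pr @^-1` (B `*` C) `&` S = \bigcap_k (X k @^-1` A' k).
    rewrite /A'; apply/seteqP; split=> [w [[/= Bw Cw] Sw] k _ /=|w Aw].
      have [->//|ki] := eqVneq k i; have [->//|kj] := eqVneq k j.
      exact: Sw.
    split; first split.
    - by have := Aw i I; rewrite /= eqxx.
    - by have := Aw j I; rewrite /= eq_sym (negbTE ij) eqxx.
    - by move=> k /= [ki kj]; have := Aw k I; rewrite /= (negbTE ki) (negbTE kj).
  rewrite XA; last by move=> k; rewrite /A'; case: ifP => // _; case: ifP.
  rewrite prodE /A' eqxx eq_sym (negbTE ij) eqxx muleC; congr (_ * _)%E.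
  by apply: eq_bigr => k /andP[/negbTE -> /negbTE ->].
(* Both sides are finite measures of D that agree on rectangles. *)
have Q (D : set (measurableTypeR R * measurableTypeR R)) : measurable D ->
    P (pr @^-1` D `&` S) = (c0 * gauss2 D)%E.
  move=> mD.
  pose G : set (set (measurableTypeR R * measurableTypeR R)) :=
    [set A `*` B | A in measurable & B in measurable].
  have E := @measure_unique _ _ _ G (fun=> setT) _ _ _ _
    (measure_function_pushforward__canonical__measure_function_Measure
       (mrestr P mS) mpr) (mscale (NngNum finec0) gauss2).
  rewrite -[c0]fineK//; apply: E => //; rewrite /= /pushforward /mscale /mrestr /=.
  - exact: measurable_prod_measurableType.
  - move=> _ _ [B mB [C mC <-]] [B' mB' [C' mC' <-]].
    exists (B `&` B'); first exact: measurableI.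
    by exists (C `&` C'); [exact: measurableI|rewrite setXI].
  - by move=> _; exists setT => //; exists setT => //; rewrite -setXTT.
  - by rewrite bigcup_const.
  - by move=> _ [B mB [C mC <-]]; rewrite Qrect// gauss2_setX// fineK.
  - move=> _; rewrite preimage_setT setTI.
    by rewrite (le_lt_trans (probability_le1 P _))// ltry.
have -> : \bigcap_k (givens_rv i j c s X k @^-1` A k) =
    pr @^-1` (rotation c s @^-1` (A i `*` A j)) `&` S.
  apply/seteqP; split=> [w Aw|w [[/= Bw Cw] Sw] k _ /=].
    split; first split.
    - by have := Aw i I; rewrite /givens_rv /= eqxx.
    - by have := Aw j I; rewrite /givens_rv /= eq_sym (negbTE ij) eqxx.
    - move=> k /= [ki kj]; have := Aw k I.
      by rewrite /givens_rv /= (negbTE ki) (negbTE kj).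
  rewrite /givens_rv; have [->//|ki] := eqVneq k i; have [->//|kj] := eqVneq k j.
  exact: (Sw k (conj ki kj)).
have mAA : measurable (A i `*` A j : set (measurableTypeR R * measurableTypeR R)).
  exact: measurableX (mA i) (mA j).
rewrite Q; last first.
  by rewrite -[X in measurable X]setTI; exact: measurable_rotation.
rewrite gauss2_rotation// gauss2_setX//.
by rewrite muleC -prodE.
Qed.

End gaussian_vector.

(** * Givens rotations of families of vectors *)

Section plane_rotations.
Context {R : realType}.

Lemma sum_two (V : nmodType) n i j (F : nat -> V) : (i < n)%N -> (j < n)%N ->
  i != j -> \sum_(k < n) F k =
  F i + F j + \sum_(k < n | (val k != i) && (val k != j)) F k.
Proof.
move=> ni nj ij; rewrite (bigD1 (Ordinal ni))//=.
by rewrite (bigD1 (Ordinal nj))/= 1?eq_sym// addrA.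
Qed.

Definition rotate (i j : nat) (c s : R) (v : nat -> R) : nat -> R :=
  fun k => if k == i then c * v i - s * v j
           else if k == j then s * v i + c * v j else v k.

Definition givens (i j : nat) (c s : R) (V : lmodType R[i]) (x : nat -> V) : nat -> V :=
  fun k => if k == i then c%:C *: x i - s%:C *: x j
           else if k == j then s%:C *: x i + c%:C *: x j else x k.

Lemma sum_rotate n i j c s (v v' : nat -> R) : (i < n)%N -> (j < n)%N ->
  i != j -> c ^+ 2 + s ^+ 2 = 1 ->
  \sum_(k < n) rotate i j c s v k * rotate i j c s v' k =
  \sum_(k < n) v k * v' k.
Proof.
move=> ni nj ij cs1.
rewrite (@sum_two _ n i j (fun k => rotate i j c s v k * rotate i j c s v' k))//.
rewrite (@sum_two _ n i j (fun k => v k * v' k))//; congr (_ + _); last first.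
  by apply: eq_bigr => k /andP[ki kj]; rewrite /rotate (negbTE ki) (negbTE kj).
rewrite /rotate !eqxx eq_sym (negbTE ij).
transitivity ((c ^+ 2 + s ^+ 2) * (v i * v' i + v j * v' j)); first by ring.
by rewrite cs1 mul1r.
Qed.

(** This moves rotations between vectors and their coefficients, be these matrix
    entries or Gaussian variables. *)
Lemma sum_givens (V : lmodType R[i]) n i j c s (v : nat -> R) (x : nat -> V) :
  (i < n)%N -> (j < n)%N -> i != j -> c ^+ 2 + s ^+ 2 = 1 ->
  \sum_(k < n) (rotate i j c s v k)%:C *: givens i j c s x k =
  \sum_(k < n) (v k)%:C *: x k.
Proof.
move=> ni nj ij cs1.
rewrite (@sum_two _ n i j (fun k => (rotate i j c s v k)%:C *: givens i j c s x k))//.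
rewrite (@sum_two _ n i j (fun k => (v k)%:C *: x k))//; congr (_ + _); last first.
  apply: eq_bigr => k /andP[ki kj].
  by rewrite /rotate /givens (negbTE ki) (negbTE kj).
rewrite /rotate /givens !eqxx eq_sym (negbTE ij).
move: (v i) (v j) (x i) (x j) => u w y z.
rewrite !scalerDr !scalerN !scalerA -!rmorphM addrACA -!scaleNr -!scalerDl.
rewrite -!rmorphN -!rmorphD /=.
have sv : - s *: w = - (s * w) by rewrite scaleNr.
have E1 : (c * u - s * w) * c + (s * u + c * w) * s = u.
  by transitivity ((c ^+ 2 + s ^+ 2) * u); [ring|rewrite cs1 mul1r].
have E2 : - ((c * u - s * w) * s) + (s * u + c * w) * c = w.
  by transitivity ((c ^+ 2 + s ^+ 2) * w); [ring|rewrite cs1 mul1r].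
by rewrite sv E1 E2.
Qed.

(** The sign is chosen so that c >= 0, which keeps the angle away from the half
    turn. *)
Lemma rotate_kill (a b : R) : exists c s : R,
  [/\ c ^+ 2 + s ^+ 2 = 1, 1 + c != 0 & s * a + c * b = 0].
Proof.
have [->|a0] := eqVneq a 0.
  by exists 0, 1; split; rewrite ?expr0n ?expr1n ?add0r ?addr0 ?oner_eq0//;
    rewrite ?mulr0 ?mul0r ?addr0.
pose r := Num.sqrt (a ^+ 2 + b ^+ 2).
have ab0 : 0 < a ^+ 2 + b ^+ 2.
  by rewrite ltr_pwDl ?sqr_ge0// exprn_even_gt0.
have r0 : 0 < r by rewrite sqrtr_gt0.
have r2 : r ^+ 2 = a ^+ 2 + b ^+ 2 by rewrite sqr_sqrtr// ltW.
exists (`|a| / r), (- (Num.sg a * b) / r); split.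
- rewrite !expr_div_n sqrrN exprMn sqr_sg a0 mul1r -mulrDl real_normK ?num_real//.
  by rewrite -r2 mulfV// expf_eq0/= gt_eqF.
- by rewrite gt_eqF// ltr_wpDr// divr_ge0// ltW.
- rewrite [- _ / r * a]mulrAC [_ / r * b]mulrAC -mulrDl [X in X / r](_ : _ = 0) ?mul0r//.
  by rewrite (normrEsg a); ring.
Qed.

End plane_rotations.

(** * Energy of a finite Gaussian sum *)

Section square_norm.
Context d (T : measurableType d) (R : realType) (mu : {measure set T -> \bar R}).
Context {E : normedModType R[i]}.
Implicit Types f g : T -> E.

Lemma strongly_measurable_sum (n : nat) (r : nat -> T -> R) (x : nat -> E) :
  (forall k, measurable_fun setT (r k)) ->
  strongly_measurable (fun t => \sum_(k < n) (r k t)%:C *: x k).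
Proof.
move=> mr; elim: n => [|n IHn].
  under eq_fun do rewrite big_ord0; exact: strongly_measurable_cst.
under eq_fun do rewrite big_ord_recr /= addrC -[(_)%:C *: _]scale1r.
by apply: strongly_measurableDZ => //; exact: strongly_measurable_scale.
Qed.

Lemma measurable_sqnorm f : strongly_measurable f ->
  measurable_fun setT (fun t => (rnorm (f t) ^+ 2)%:E).
Proof.
move=> sf; apply/measurable_EFinP/measurable_funX.
exact: strongly_measurable_rnorm.
Qed.

Lemma sqr_ler_rnormD (x y : E) :
  rnorm (x + y) ^+ 2 <= 2 * rnorm x ^+ 2 + 2 * rnorm y ^+ 2.
Proof.
apply: (@le_trans _ _ ((rnorm x + rnorm y) ^+ 2)).
  by rewrite ler_sqr ?nnegrE ?addr_ge0 ?rnorm_ge0// ler_rnormD.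
rewrite -subr_ge0 (_ : _ - _ = (rnorm x - rnorm y) ^+ 2) ?sqr_ge0//.
by ring.
Qed.

Lemma rnormN (x : E) : rnorm (- x) = rnorm x.
Proof. by rewrite /rnorm normrN. Qed.

Lemma int_sqnorm_ge0 D f : (0 <= int_sqnorm mu D f)%E.
Proof. by apply: integral_ge0 => t _; rewrite lee_fin sqr_ge0. Qed.

Lemma int_sqnorm_le2D f g : strongly_measurable f -> strongly_measurable g ->
  (int_sqnorm mu setT (fun t => (f t + g t)%R) <=
   2%:E * int_sqnorm mu setT f + 2%:E * int_sqnorm mu setT g)%E.
Proof.
move=> sf sg; have mf := measurable_sqnorm sf; have mg := measurable_sqnorm sg.
have ge0 (h : T -> E) t : setT t -> (0 <= (rnorm (h t) ^+ 2)%:E)%E.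
  by move=> _; rewrite lee_fin sqr_ge0.
have ge02 (h : T -> E) t : setT t -> (0 <= 2%:E * (rnorm (h t) ^+ 2)%:E)%E.
  by move=> _; rewrite mule_ge0// ge0.
rewrite /int_sqnorm -!ge0_integralZl_EFin//; [|exact: ge0|exact: ge0].
rewrite -ge0_integralD//; [|exact: ge02|exact: measurable_funeM
  |exact: ge02|exact: measurable_funeM].
apply: ge0_le_integral => //.
- by move=> t _; exact: (ge0 (fun t => f t + g t)).
- apply: measurable_sqnorm.
  under eq_fun do rewrite -[f _]scale1r.
  exact: strongly_measurableDZ.
- by apply: emeasurable_funD; exact: measurable_funeM.
by move=> t _; rewrite -!EFinM -EFinD lee_fin sqr_ler_rnormD.
Qed.

End square_norm.

Section energy.
Context d (Omega : measurableType d) (R : realType) (P : probability Omega R).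
Variable gam : nat -> {RV P >-> R}.
Hypothesis gamG : gaussian_sequence gam.
Context {E : normedModType R[i]}.
Implicit Types x y : nat -> E.

Lemma gaussian_sequence_vector n : gaussian_vector P (fun k : 'I_n => gam k : Omega -> R).
Proof.
have [lawg indg] := gamG; split=> [k|A mA]; first exact: measurable_funPT.
pose B k : set R := if insub k is Some i then A i else setT.
have BE (k : 'I_n) : B k = A k by rewrite /B valK.
pose J : {fset nat} := [fset k in iota 0 n]%fset.
have JE k : (k \in J) = (k < n)%N by rewrite inE mem_iota.
have mB k : measurable (B k) by rewrite /B; case: insubP.
rewrite (_ : \bigcap_k _ = \bigcap_(j in [set` J]) (gam j @^-1` B j)); last first.
  apply/seteqP; split=> [w Aw k /=|w Aw k _ /=].
    by rewrite JE => kn; rewrite (BE (Ordinal kn)); exact: (Aw (Ordinal kn)).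
  by rewrite -BE; apply: Aw => /=; rewrite JE.
rewrite indg//.
transitivity (\prod_(0 <= k < n) P (gam k @^-1` B k))%E.
  have pJ : perm_eq J (iota 0 n).
    by apply: uniq_perm => [||k]; [exact: fset_uniq|exact: iota_uniq|
      rewrite JE mem_iota].
  by rewrite /index_iota subn0 (perm_big _ pJ).
rewrite big_mkord; apply: eq_bigr => k _.
by rewrite BE; exact: lawg.
Qed.

Definition energy n x : \bar R := int_sqnorm P setT (gauss_psum gam x n).

Lemma strongly_measurable_psum n x : strongly_measurable (gauss_psum gam x n).
Proof.
apply: (@strongly_measurable_sum _ _ _ _ n (fun k => gam k : Omega -> R) x) => k.
exact: measurable_funPT.
Qed.

Lemma eq_energy n x y : (forall k, (k < n)%N -> x k = y k) ->
  energy n x = energy n y.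
Proof.
move=> xy; congr (int_sqnorm _ _ _); apply/funext => w.
by apply: eq_bigr => k _; rewrite xy.
Qed.

(** Only the law of the Gaussian vector matters. *)
Lemma energy_law n x (X : 'I_n -> Omega -> R) : gaussian_vector P X ->
  int_sqnorm P setT (fun w => \sum_(k < n) (X k w)%:C *: x k) = energy n x.
Proof.
move=> gX.
pose f (t : n.-tuple R) : \bar R :=
  (rnorm (\sum_(k < n) (tnth t k)%:C *: x k) ^+ 2)%:E.
have mf : measurable_fun setT f.
  pose r k (t : n.-tuple R) : R := if insub k is Some i then tnth t i else 0.
  have -> : f = fun t => (rnorm (\sum_(k < n) (r k t)%:C *: x k) ^+ 2)%:E.
    apply/funext => t; rewrite /f; congr ((rnorm _ ^+ 2)%:E).
    by apply: eq_bigr => k _; rewrite /r valK.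
  apply: measurable_sqnorm; apply: strongly_measurable_sum => k.
  by rewrite /r; case: insubP => [i _ _|_]; [exact: measurable_tnth|].
have f0 t : (0 <= f t)%E by rewrite lee_fin sqr_ge0.
have := gaussian_vector_law gX (gaussian_sequence_vector n) mf f0.
rewrite /f; under eq_integral => w _ do
  under eq_bigr => k _ do rewrite tnth_mktuple.
move=> law; rewrite /int_sqnorm law; apply: eq_integral => w _.
by congr ((rnorm _ ^+ 2)%:E); apply: eq_bigr => k _; rewrite tnth_mktuple.
Qed.

Lemma energyE n x : energy n x = int_sqnorm P setT (gauss_psum gam x n).
Proof. by []. Qed.

(** Undo the rotation of x on the Gaussian variables, which keeps them Gaussian. *)
Lemma energy_givens n i j c s x : (i < n)%N -> (j < n)%N -> i != j ->
  c ^+ 2 + s ^+ 2 = 1 -> 1 + c != 0 ->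
  energy n (givens i j c s x) = energy n x.
Proof.
move=> ni nj ij cs1 c1.
have ij' : Ordinal ni != Ordinal nj by [].
have gX := gaussian_vector_givens ij' cs1 c1 (gaussian_sequence_vector n).
rewrite -(energy_law _ gX); congr int_sqnorm; apply/funext => w.
transitivity (\sum_(k < n) (rotate i j c s (gam ^~ w) k)%:C *: givens i j c s x k).
  by apply: eq_bigr.
exact: sum_givens.
Qed.

Lemma energy_pad m n x : (m <= n)%N -> (forall k, (m <= k < n)%N -> x k = 0) ->
  energy n x = energy m x.
Proof.
move=> mn x0; congr int_sqnorm; apply/funext => w; rewrite /gauss_psum.
rewrite -!(big_mkord xpredT (fun k => (gam k w)%:C *: x k)).
rewrite (big_cat_nat (leq0n m) mn)//=.
rewrite [X in _ + X = _]big1_seq ?addr0// => k; rewrite mem_index_iota => /x0 ->.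
by rewrite scaler0.
Qed.

Definition flip (i : nat) (x : nat -> E) : nat -> E :=
  fun k => if k == i then - x k else x k.

(** A rotation by pi in the plane of i and of an additional coordinate carrying
    the vector 0; it is done in two quarter turns since the half turn has
    c = -1. *)
Lemma energy_flip n i x : (i < n)%N -> energy n (flip i x) = energy n x.
Proof.
move=> ni.
pose x0 k := if k == n then 0 else x k.
have x0n : energy n.+1 x0 = energy n x.
  rewrite (@energy_pad n n.+1)//.
    by apply: eq_energy => k kn; rewrite /x0 ltn_eqF.
  by move=> k; rewrite ltnS -eqn_leq => /eqP <-; rewrite /x0 eqxx.
have fE : energy n.+1 (givens i n 0 1 (givens i n 0 1 x0)) = energy n (flip i x).
  rewrite (@energy_pad n n.+1)//.
    apply: eq_energy => k kn.
    rewrite /givens /flip /x0 !eqxx (ltn_eqF kn) (ltn_eqF ni) [n == i]gtn_eqF//.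
    have [->|//] := eqVneq k i.
    by rewrite !scale1r !scale0r addr0 add0r.
  move=> k; rewrite ltnS -eqn_leq => /eqP <-.
  rewrite /givens /x0 !eqxx [n == i]gtn_eqF// (ltn_eqF ni).
  by rewrite !(scaler0, scale0r, scale1r, subr0, addr0, oppr0).
have cs1 : 0 ^+ 2 + 1 ^+ 2 = 1 :> R by rewrite expr0n expr1n add0r.
have c1 : 1 + 0 != 0 :> R by rewrite addr0 oner_eq0.
have i_n : i != n by rewrite ltn_eqF.
by rewrite -fE -x0n !energy_givens// (ltn_trans ni).
Qed.

Lemma energy_signs n (e : nat -> bool) x :
  energy n (fun k => if e k then - x k else x k) = energy n x.
Proof.
suff H m : (m <= n)%N ->
    energy n (fun k => if (k < m)%N && e k then - x k else x k) = energy n x.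
  by rewrite -(H n)//; apply: eq_energy => k ->.
elim: m => [|m IHm] mn; first by apply: eq_energy.
rewrite -IHm; last exact: ltnW.
case em : (e m).
  rewrite -(energy_flip _ mn); apply: eq_energy => k _; rewrite /flip ltnS.
  have [->|km] := eqVneq k m; first by rewrite leqnn ltnn em opprK.
  by rewrite (leq_eqVlt k) (negbTE km).
apply: eq_energy => k _; rewrite ltnS leq_eqVlt.
by have [->|//] := eqVneq k m; rewrite em !andbF.
Qed.

Lemma psumS n x w : gauss_psum gam x n.+1 w =
  gauss_psum gam x n w + (gam n w)%:C *: x n.
Proof. by rewrite /gauss_psum big_ord_recr. Qed.

(** Let S be the sum of the first n terms and v the next one. Then S + v and S - v
    have the same energy by symmetry, and 2 |S|^2 <= |S + v|^2 + |S - v|^2. *)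
Lemma energy_leS n x : (energy n x <= energy n.+1 x)%E.
Proof.
have flipE w : gauss_psum gam (flip n x) n.+1 w =
    gauss_psum gam x n w - (gam n w)%:C *: x n.
  rewrite psumS {2}/flip eqxx scalerN; congr (_ - _).
  by apply: eq_bigr => k _; rewrite /flip ltn_eqF.
have flipn := energy_flip x (ltnSn n).
suff : (2%:E * energy n x <= energy n.+1 x + energy n.+1 (flip n x))%E.
  by rewrite flipn -mule2n -mule_natl lee_pmul2l// lte_fin.
have mS y m : measurable_fun setT (fun w => (rnorm (gauss_psum gam y m w) ^+ 2)%:E).
  exact/measurable_sqnorm/strongly_measurable_psum.
have S0 y m w : setT w -> (0 <= (rnorm (gauss_psum gam y m w) ^+ 2)%:E)%E.
  by move=> _; rewrite lee_fin sqr_ge0.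
rewrite /energy /int_sqnorm -ge0_integralZl_EFin//; last exact: S0.
rewrite -ge0_integralD//; [|exact: S0|exact: S0].
apply: ge0_le_integral => //.
- by move=> w _; rewrite mule_ge0// S0.
- exact: measurable_funeM.
- exact: emeasurable_funD.
move=> w _; rewrite -EFinM -EFinD lee_fin flipE psumS.
have := sqr_ler_rnormD (gauss_psum gam x n w + (gam n w)%:C *: x n)
  (gauss_psum gam x n w - (gam n w)%:C *: x n).
rewrite addrACA subrr addr0 -mulr2n -scaler_nat rnormZ.
rewrite (_ : complex.Re `|_| = 2); first by rewrite exprMn; lra.
by rewrite normr_nat -(rmorph_nat (real_complex R)).
Qed.

Lemma energy_le m n x : (m <= n)%N -> (energy m x <= energy n x)%E.
Proof.
move=> /subnK <-; elim: (n - m)%N => // k IHk.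
by rewrite addSn (le_trans IHk)// energy_leS.
Qed.

End energy.

(** * Cholesky factorization of semidefinite forms *)

Section cholesky.
Context {R : realFieldType}.
Implicit Types (S : nat -> nat -> R) (t : nat -> R).

Definition quad N S t : R := \sum_(i < N) \sum_(j < N) t i * t j * S i j.

Lemma quadS N S t : (forall i j, S i j = S j i) ->
  quad N.+1 S t = quad N S t + 2 * t N * (\sum_(i < N) t i * S i N) +
    t N ^+ 2 * S N N.
Proof.
move=> symS; rewrite /quad big_ord_recr /=.
under eq_bigr do rewrite big_ord_recr /=.
rewrite big_split /= big_ord_recr /= -!addrA; congr (_ + _).
rewrite addrA -expr2; congr (_ + _).
rewrite -mulrA mulr_natl mulr2n mulr_sumr; congr (_ + _).
  by apply: eq_bigr => i _; ring.
by apply: eq_bigr => i _; rewrite [S N i]symS; ring.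
Qed.

Lemma eq_quad N S t t' : (forall i, (i < N)%N -> t i = t' i) ->
  quad N S t = quad N S t'.
Proof.
by move=> tt'; apply: eq_bigr => i _; apply: eq_bigr => j _; rewrite !tt'.
Qed.

End cholesky.

Section cholesky_rcf.
Context {R : rcfType}.
Implicit Types (S : nat -> nat -> R) (t : nat -> R).

(** Induction on N with the last index as pivot p: S N N = p. A null pivot forces
    the column S i N to vanish, so that dividing by p = 0 is harmless. *)
Lemma cholesky N S : (forall i j, S i j = S j i) ->
  (forall t, 0 <= quad N S t) ->
  exists L : nat -> nat -> R, forall i j, (i < N)%N -> (j < N)%N ->
    S i j = \sum_(k < N) L i k * L j k.
Proof.
elim: N S => [|N IHN] S symS posS; first by exists (fun _ _ => 0).
pose upd t (a : R) k := if k == N then a else t k.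
have updE t a i : (i < N)%N -> upd t a i = t i by move=> iN; rewrite /upd ltn_eqF.
have quadU t a : quad N.+1 S (upd t a) =
    quad N S t + 2 * a * (\sum_(i < N) t i * S i N) + a ^+ 2 * S N N.
  rewrite quadS// /upd eqxx (@eq_quad _ N S _ t); last exact: updE.
  congr (_ + _ * _ + _); apply: eq_bigr => i _.
  by rewrite [in LHS]ltn_eqF.
pose p := S N N.
have p0 : 0 <= p.
  have := posS (upd (fun=> 0) 1); rewrite quadU /quad big1; last first.
    by move=> i _; rewrite big1// => j _; rewrite !mul0r.
  rewrite big1; last by move=> i _; rewrite mul0r.
  by rewrite mulr0 !add0r expr1n mul1r.
(* Otherwise the form, affine in the last coordinate, would take negative
     values. *)
have piv0 i : (i < N)%N -> p = 0 -> S i N = 0.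
  move=> iN pz; apply/eqP/negPn/negP => Sn0.
  pose t k : R := (k == i)%:R.
  have := posS (upd t (- (quad N S t + 1) / (2 * S i N))).
  rewrite quadU -/p pz mulr0 addr0 (bigD1 (Ordinal iN))//= big1 ?addr0; last first.
    move=> j; rewrite -val_eqE /= => /negbTE ji.
    by rewrite /t ji mul0r.
  rewrite /t eqxx mul1r -/t.
  suff -> : quad N S t + 2 * (- (quad N S t + 1) / (2 * S i N)) * S i N = - 1.
    by rewrite lerNr oppr0 ler10.
  by field.
pose S' i j := S i j - S i N * S j N / p.
have [||L LE] := IHN S'.
- by move=> i j; rewrite /S' symS; ring.
- move=> t.
  (* The last coordinate minimizing the form turns it into its Schur
     complement. *)
  have := posS (upd t (- (\sum_(i < N) t i * S i N) / p)); rewrite quadU -/p.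
  set s := \sum_(i < N) _.
  have -> : quad N S' t = quad N S t - s * s / p.
    rewrite /quad /s !mulr_suml -sumrB; apply: eq_bigr => i _.
    rewrite mulr_sumr mulr_suml -sumrB; apply: eq_bigr => j _.
    by rewrite /S'; ring.
  suff -> : quad N S t + 2 * (- s / p) * s + (- s / p) ^+ 2 * p =
      quad N S t - s * s / p by [].
  have [->|pn0] := eqVneq p 0; first by rewrite invr0; ring.
  by field.
exists (fun i k => if k == N then (if i == N then Num.sqrt p else S i N / Num.sqrt p)
           else if i == N then 0 else L i k).
move=> i j iN jN; rewrite big_ord_recr /= eqxx.
under eq_bigr => k _ do rewrite (ltn_eqF (ltn_ord k)).
have sp : Num.sqrt p * Num.sqrt p = p by rewrite -expr2 sqr_sqrtr.
have canc k : (k < N)%N -> S k N / Num.sqrt p * Num.sqrt p = S k N.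
  move=> kN; have [p_0|pn0] := eqVneq p 0; first by rewrite (piv0 _ kN p_0) !mul0r.
  by rewrite mulfVK// sqrtr_eq0 -ltNge lt_neqAle eq_sym pn0.
have [->|iN'] := eqVneq i N.
  rewrite big1 ?add0r; last by move=> k _; rewrite mul0r.
  have [->|jN'] := eqVneq j N; first by rewrite sp.
  by rewrite mulrC canc 1?symS// ltn_neqAle jN' -ltnS.
have {iN}iN : (i < N)%N by rewrite ltn_neqAle iN' -ltnS.
have [->|jN'] := eqVneq j N.
  rewrite big1 ?add0r; last by move=> k _; rewrite mulr0.
  by rewrite canc.
have {jN}jN : (j < N)%N by rewrite ltn_neqAle jN' -ltnS.
rewrite -LE// /S' [X in _ + X](_ : _ = S i N * S j N / p) ?subrK//.
by rewrite mulrACA -invfM sp.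
Qed.

End cholesky_rcf.

(** * Contractions decrease the energy *)

Section contraction.
Context d (Omega : measurableType d) (R : realType) (P : probability Omega R).
Variable gam : nat -> {RV P >-> R}.
Hypothesis gamG : gaussian_sequence gam.
Context {E : normedModType R[i]}.
Implicit Types (x : nat -> E) (W : nat -> nat -> R).
Local Notation energy := (energy gam).

Definition act K W x : nat -> E := fun r => \sum_(l < K) (W r l)%:C *: x l.

Definition orthonormal_rows N K W :=
  forall r r', (r < N)%N -> (r' < N)%N ->
    \sum_(l < K) W r l * W r' l = (r == r')%:R.

Definition diag_upto n K W :=
  forall r l, (r < n)%N -> (l < K)%N -> l != r -> W r l = 0.

Lemma orthonormal_rows_support N K W n : orthonormal_rows N K W ->
  (n < N)%N -> (forall l, (l < K)%N -> l != n -> W n l = 0) ->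
  (n < K)%N /\ W n n ^+ 2 = 1.
Proof.
move=> oW nN W0; have := oW n n nN nN; rewrite eqxx.
have [nK|Kn] := ltnP n K.
  rewrite (bigD1 (Ordinal nK))//= big1 ?addr0; first by rewrite -expr2.
  by move=> l; rewrite -val_eqE /= => ln; rewrite W0 ?mul0r.
rewrite big1 => [/eqP|l _]; first by rewrite eq_sym oner_eq0.
by rewrite W0 ?mul0r// ltn_eqF// (leq_trans (ltn_ord l)).
Qed.

(** A diagonal matrix with orthonormal rows only changes signs and drops the
    vectors beyond the first N. *)
Lemma energy_diag N K W x : orthonormal_rows N K W -> diag_upto N K W ->
  (energy N (act K W x) <= energy K x)%E.
Proof.
move=> oW dW.
have sW n : (n < N)%N -> (n < K)%N /\ W n n ^+ 2 = 1.
  by move=> nN; apply: (orthonormal_rows_support oW) => // l lK; exact: dW.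
have NK : (N <= K)%N.
  by rewrite leqNgt; apply/negP => /sW[]; rewrite ltnn.
apply: le_trans (energy_le gamG x NK).
rewrite -(energy_signs gamG N (fun n => W n n == -1) x).
rewrite le_eqVlt; apply/orP; left; apply/eqP/eq_energy => n nN.
have [nK Wn] := sW n nN.
rewrite /act (bigD1 (Ordinal nK))//= big1 ?addr0; last first.
  by move=> l; rewrite -val_eqE /= => ln; rewrite dW ?scale0r.
case: ifPn => [/eqP ->|Wn1]; first by rewrite rmorphN1 scaleN1r.
move/eqP : Wn; rewrite sqrf_eq1 (negbTE Wn1) orbF => /eqP ->.
by rewrite scale1r.
Qed.

(** The rows are made diagonal one after the other; in row n, rotations in the
    planes (n, k) cancel the entries k > n, while the entries l < n already vanish
    by orthogonality to the previous rows. The same rotations are applied to the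
    vectors, so that neither side changes. *)
Lemma energy_orthonormal N K W x : orthonormal_rows N K W ->
  (energy N (act K W x) <= energy K x)%E.
Proof.
move=> oW; have : diag_upto 0 K W by [].
have : (0 + N = N)%N by [].
move: {1 2}0%N => n; move: {1}N => m.
elim: m n W x oW => [|m IHm] n W x oW.
  by rewrite addn0 => ->; exact: energy_diag.
rewrite addnS -addSn => nmN dW.
have nN : (n < N)%N by rewrite -nmN leq_addr.
have lt_n (V : nat -> nat -> R) : orthonormal_rows N K V -> diag_upto n K V ->
    forall l, (l < K)%N -> (l < n)%N -> V n l = 0.
  move=> oV dV l lK ln.
  have lN := ltn_trans ln nN.
  have [_ Vl] : (l < K)%N /\ V l l ^+ 2 = 1.
    by apply: (orthonormal_rows_support oV) => // k kK; exact: dV.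
  have := oV l n lN nN; rewrite ltn_eqF// (bigD1 (Ordinal lK))//= big1 ?addr0.
    move/eqP; rewrite mulf_eq0 => /orP[/eqP Vl0|/eqP//].
    by move: Vl => /eqP; rewrite Vl0 expr0n eq_sym oner_eq0.
  by move=> k; rewrite -val_eqE /= => kl; rewrite dV ?mul0r.
have nK : (n < K)%N.
  rewrite ltnNge; apply/negP => Kn.
  have [] := orthonormal_rows_support oW nN; last by rewrite ltnNge Kn.
  by move=> l lK _; apply: lt_n => //; exact: leq_trans Kn.
have : forall l, (l < K)%N -> (n < l < n.+1)%N -> W n l = 0.
  by move=> l _; rewrite ltnS; case: ltngtP.
have : (n.+1 + (K - n.+1) = K)%N by rewrite subnKC.
have : (n < n.+1)%N by [].
move: {2 3 6}n.+1 => k; move: (K - n.+1)%N => p.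
elim: p k W x oW dW => [|p IHp] k W x oW dW nk.
  rewrite addn0 => kK W0; apply: (IHm n.+1) => // r l; rewrite ltnS leq_eqVlt.
  case/orP => [/eqP ->|]; last exact: dW.
  move=> lK; rewrite neq_ltn => /orP[ln|nl]; first exact: lt_n.
  by apply: W0 => //; rewrite nl kK.
rewrite addnS -addSn => kpK W0.
have kK : (k < K)%N by rewrite -kpK leq_addr.
have [c [s [cs1 c1 kill]]] := rotate_kill (W n n) (W n k).
have nk' : n != k by rewrite ltn_eqF.
pose W' r := rotate n k c s (W r).
have actE r : act K W' (givens n k c s x) r = act K W x r.
  exact: sum_givens.
rewrite -(@eq_energy _ _ _ _ _ _ N (act K W' (givens n k c s x))); last first.
  by move=> r _; exact: actE.
rewrite -(energy_givens gamG x nK kK nk' cs1 c1).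
apply: (IHp k.+1) => //.
- by move=> r r' rN r'N; rewrite sum_rotate// oW.
- move=> r l rn lK lr; rewrite /W' /rotate.
  have Wrn : W r n = 0 by apply: dW => //; rewrite gtn_eqF.
  have Wrk : W r k = 0 by apply: dW => //; rewrite gtn_eqF// (ltn_trans rn).
  rewrite Wrn Wrk !mulr0 subr0 addr0; case: ifP => // _; case: ifP => // _.
  exact: dW.
- exact: (ltn_trans nk).
- move=> l lK /andP[nl]; rewrite ltnS leq_eqVlt /W' /rotate [l == n]gtn_eqF//.
  case: eqP => [_ _|_ /= lk]; first exact: kill.
  by apply: W0 => //; rewrite nl.
Qed.

(** The columns of C are appended to those of B, with the coefficient 0 in x: the
    rows become orthonormal and neither energy changes. *)
Lemma energy_contraction N M (B : nat -> nat -> R) x :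
  (forall t : nat -> R, \sum_(l < M) (\sum_(n < N) t n * B n l) ^+ 2 <=
    \sum_(n < N) t n ^+ 2) ->
  (energy N (act M B x) <= energy M x)%E.
Proof.
move=> cB.
pose S i j := (i == j)%:R - \sum_(l < M) B i l * B j l.
have [||C CE] := @cholesky R N S.
- by move=> i j; rewrite /S eq_sym; under eq_bigr do rewrite mulrC.
- move=> t; rewrite [leRHS](_ : _ = \sum_(n < N) t n ^+ 2 -
      \sum_(l < M) (\sum_(n < N) t n * B n l) ^+ 2) ?subr_ge0//.
  transitivity (\sum_(i < N) \sum_(j < N) t i * t j * (i == j)%:R -
      \sum_(i < N) \sum_(j < N) \sum_(l < M) (t i * B i l) * (t j * B j l)).
    rewrite -sumrB; apply: eq_bigr => i _; rewrite -sumrB; apply: eq_bigr => j _.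
    rewrite /S mulrBr mulr_sumr -val_eqE; congr (_ - _).
    by apply: eq_bigr => l _; ring.
  congr (_ - _).
    apply: eq_bigr => i _; rewrite (bigD1 i)//= eqxx mulr1 -expr2 big1 ?addr0//.
    by move=> j; rewrite eq_sym => /negbTE ->; rewrite mulr0.
  under eq_bigr do rewrite exchange_big /=.
  rewrite exchange_big /=; apply: eq_bigr => l _.
  by rewrite expr2 mulr_suml; apply: eq_bigr => i _; rewrite mulr_sumr.
pose W r l := if (l < M)%N then B r l else C r (l - M)%N.
pose x0 l := if (l < M)%N then x l else 0.
rewrite -[leRHS](_ : energy (M + N) x0 = _); last first.
  rewrite (@energy_pad _ _ _ _ _ _ M) ?leq_addr//.
    by apply: eq_energy => l lM; rewrite /x0 lM.
  by move=> l /andP[Ml _]; rewrite /x0 ltnNge Ml.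
rewrite (@eq_energy _ _ _ _ _ _ N _ (act (M + N) W x0)); last first.
  move=> r _; rewrite /act big_split_ord /= [X in _ = _ + X]big1 ?addr0.
    by apply: eq_bigr => l _; rewrite /W /x0 ltn_ord.
  by move=> l _; rewrite /x0 ltnNge leq_addr scaler0.
apply: energy_orthonormal => r r' rN r'N.
rewrite big_split_ord /=.
transitivity (\sum_(l < M) B r l * B r' l + \sum_(l < N) C r l * C r' l).
  congr (_ + _); apply: eq_bigr => l _; rewrite /W ?ltn_ord//.
  by rewrite ltnNge leq_addr /= addKn.
by rewrite -CE// /S addrC subrK.
Qed.

Lemma energyZ n (z : R[i]) x :
  (energy n (fun k => (z *: x k)%R) = (complex.Re `|z| ^+ 2)%:E * energy n x)%E.
Proof.
rewrite !energyE /int_sqnorm -ge0_integralZl_EFin ?sqr_ge0//.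
- apply: eq_integral => w _; rewrite -EFinM -exprMn -rnormZ; congr ((rnorm _ ^+ 2)%:E).
  rewrite /gauss_psum scaler_sumr; apply: eq_bigr => k _.
  by rewrite !scalerA mulrC.
- by move=> w _; rewrite lee_fin sqr_ge0.
- exact/measurable_sqnorm/strongly_measurable_psum.
Qed.

Lemma energyD n x y : (energy n (fun k => (x k + y k)%R) <=
  2%:E * energy n x + 2%:E * energy n y)%E.
Proof.
rewrite !energyE (_ : gauss_psum _ _ _ =
    fun w => gauss_psum gam x n w + gauss_psum gam y n w); last first.
  apply/funext => w; rewrite /gauss_psum -big_split /=.
  by apply: eq_bigr => k _; rewrite scalerDr.
by apply: int_sqnorm_le2D; exact: strongly_measurable_psum.
Qed.

Lemma energy_contraction_scaled N M (B : nat -> nat -> R) (c : R) x : 0 < c ->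
  (forall t : nat -> R, \sum_(l < M) (\sum_(n < N) t n * B n l) ^+ 2 <=
    c ^+ 2 * \sum_(n < N) t n ^+ 2) ->
  (energy N (act M B x) <= (c ^+ 2)%:E * energy M x)%E.
Proof.
move=> c0 cB; have cn0 : c != 0 by rewrite gt_eqF.
have -> : ((c ^+ 2)%:E * energy M x = energy M (fun k => c%:C *: x k))%E.
  by rewrite energyZ normc_def /= expr0n addr0 sqrtr_sqr real_normK ?num_real.
rewrite (@eq_energy _ _ _ _ _ _ N _
    (act M (fun n l => B n l / c) (fun k => c%:C *: x k))); last first.
  move=> n _; apply: eq_bigr => l _.
  by rewrite scalerA -rmorphM /= mulfVK.
apply: energy_contraction => t.
rewrite (eq_bigr (fun l : 'I_M => c ^- 2 * (\sum_(n < N) t n * B n l) ^+ 2)).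
  by rewrite -mulr_sumr mulrC ler_pdivrMr ?exprn_gt0// mulrC.
move=> l _; rewrite -exprVn -exprMn mulr_sumr; congr (_ ^+ 2).
by apply: eq_bigr => n _; ring.
Qed.

(** The real and the imaginary part of the matrix satisfy the same bound, the
    vector t being real. Each loses a factor 2 through
    |u + v|^2 <= 2 |u|^2 + 2 |v|^2. *)
Lemma energy_complex_contraction N M (a : nat -> nat -> R[i]) (c : R) x :
  0 < c ->
  (forall t : nat -> R, \sum_(l < M) ((\sum_(n < N) t n * complex.Re (a n l)) ^+ 2
     + (\sum_(n < N) t n * complex.Im (a n l)) ^+ 2) <=
    c ^+ 2 * \sum_(n < N) t n ^+ 2) ->
  (energy N (fun n => \sum_(l < M) a n l *: x l)%R <=
    (4 * c ^+ 2)%:E * energy M x)%E.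
Proof.
move=> c0 ca.
pose ix l := 'i *: x l.
rewrite (@eq_energy _ _ _ _ _ _ N _ (fun n =>
    act M (fun n l => complex.Re (a n l)) x n +
    act M (fun n l => complex.Im (a n l)) ix n)); last first.
  move=> n _; rewrite /act -big_split; apply: eq_bigr => l _ /=.
  rewrite /ix scalerA -scalerDl; congr (_ *: _).
  by rewrite mulrC -complexE.
apply: le_trans (energyD _ _ _) _.
have iE : energy M ix = energy M x.
  by rewrite energyZ normc_def /= expr0n expr1n add0r sqrtr1 expr1n mul1e.
have -> : ((4 * c ^+ 2)%:E * energy M x = 2%:E * ((c ^+ 2)%:E * energy M x) +
    2%:E * ((c ^+ 2)%:E * energy M ix))%E.
  rewrite iE !muleA -!EFinM -ge0_muleDl ?lee_fin ?mulr_ge0 ?sqr_ge0 ?(ltW c0)//.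
  by rewrite -EFinD; congr (_%:E * _)%E; ring.
apply: leeD; apply: lee_wpmul2l; rewrite ?lee_fin//;
  apply: energy_contraction_scaled => // t; apply: le_trans (ca t);
  by apply: ler_sum => l _; rewrite ?lerDl ?lerDr sqr_ge0.
Qed.

End contraction.

(** * Convergence of sequences and series *)

Section real_series.
Context {R : realType}.

Lemma ereal_cvg0P (F : nat -> \bar R) : (forall n, 0 <= F n)%E ->
  (F n @[n --> \oo] --> 0%E) <->
  (forall e : R, 0 < e -> exists N, forall n, (N <= n)%N -> (F n <= e%:E)%E).
Proof.
move=> F0; split=> [F_0 e e0|H].
  move/fine_cvgP : F_0 => [Ffin /cvgrPdist_le /(_ _ e0)[N _ NF]].
  case: Ffin => M _ MF; exists (maxn N M) => n; rewrite geq_max => /andP[Nn Mn].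
  have := NF n Nn; rewrite /= sub0r normrN => Fe.
  rewrite -[F n]fineK; last exact: MF.
  by rewrite lee_fin; apply: le_trans Fe; exact: ler_norm.
apply/fine_cvgP; split.
  have [N HN] := H 1 ltr01; exists N => // n /= /HN F1.
  by rewrite ge0_fin_numE// (le_lt_trans F1)// ltry.
apply/cvgrPdist_le => e e0; have [N HN] := H e e0.
exists N => // n /= /HN Fe; rewrite sub0r normrN.
have Fn : F n \is a fin_num by rewrite ge0_fin_numE// (le_lt_trans Fe)// ltry.
by rewrite ger0_norm ?fine_ge0// -lee_fin fineK.
Qed.

Lemma nneseries_small (d : nat -> R) : (forall k, 0 <= d k) ->
  (\sum_(k <oo) (d k)%:E < +oo)%E ->
  forall e, 0 < e -> exists N, forall n, \sum_(N <= k < n) d k < e.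
Proof.
move=> d0 doo e e0.
have dE0 k : (0 <= (d k)%:E)%E by rewrite lee_fin.
have tl : (\sum_(N <= k <oo) (d k)%:E)%E @[N --> \oo] --> 0%E.
  by apply: nneseries_tail_cvg => // k _; exact: dE0.
have tl0 N : (0 <= \sum_(N <= k <oo) (d k)%:E)%E by apply: nneseries_ge0.
have e20 : 0 < e / 2 by rewrite divr_gt0.
have [N /(_ N (leqnn N)) Ne] := (ereal_cvg0P tl0).1 tl _ e20.
exists N => n; rewrite -lte_fin -sumEFin.
apply: (@le_lt_trans _ _ (\sum_(N <= k <oo) (d k)%:E)%E).
  exact: nneseries_lim_ge.
by rewrite (le_lt_trans Ne)// lte_fin ltr_pdivrMr// ltr_pMr// ltr1n.
Qed.

End real_series.

Section rnorm_convergence.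
Context {R : realType} {E : normedModType R[i]}.

Lemma cvg_rnormP (u : nat -> E) (l : E) : u n @[n --> \oo] --> l <->
  (forall e, 0 < e -> exists N, forall n, (N <= n)%N -> rnorm (u n - l) < e).
Proof.
split=> [/cvgrPdist_lt ul e e0|H].
  have e0C : 0 < e%:C :> R[i] by rewrite ltcR.
  have [N _ NH] := ul _ e0C; exists N => n Nn.
  by rewrite -ltcR rnormE distrC; exact: NH.
apply/cvgrPdist_lt => e e0.
have eE : (complex.Re e)%:C = e by exact/RRe_real/gtr0_real.
have e0' : 0 < complex.Re e by rewrite -ltcR eE.
have [N NH] := H _ e0'; exists N => // n /= /NH.
by rewrite distrC -rnormE -eE ltcR.
Qed.

End rnorm_convergence.

Section rnorm_complete.
Context {R : realType} {E : completeNormedModType R[i]}.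

Lemma rnorm_cauchy_cvg (u : nat -> E) :
  (forall e, 0 < e -> exists N, forall n, (N <= n)%N -> rnorm (u n - u N) < e) ->
  cvg (u n @[n --> \oo]).
Proof.
move=> H; apply/cauchy_cvgP/cauchy_exP => e e0.
have eE : (complex.Re e)%:C = e by exact/RRe_real/gtr0_real.
have e0' : 0 < complex.Re e by rewrite -ltcR eE.
have [N NH] := H _ e0'; exists (u N); exists N => // n /= /NH.
by rewrite -ball_normE /ball_ /= distrC -rnormE -eE ltcR.
Qed.

Lemma rnorm_series_cvg (u : nat -> E) :
  (\sum_(k <oo) (rnorm (u k.+1 - u k))%:E < +oo)%E -> cvg (u n @[n --> \oo]).
Proof.
move=> sumu; apply: rnorm_cauchy_cvg => e e0.
have [N NH] := nneseries_small (fun k => rnorm_ge0 (u k.+1 - u k)) sumu e0.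
exists N => n Nn; apply: le_lt_trans (NH n).
rewrite -(subnK Nn); elim: (n - N)%N => [|k IHk].
  by rewrite add0n subrr /rnorm normr0 big_geq.
rewrite addSn big_nat_recr/= ?leq_addl// -(subrKA (u (k + N)%N)).
by rewrite (le_trans (ler_rnormD _ _))// [leRHS]addrC lerD2l.
Qed.

End rnorm_complete.

(** * Completeness of L^2 for strongly measurable functions *)

Section fatou_bound.
Context d (T : measurableType d) (R : realType) (mu : {measure set T -> \bar R}).

(** The complement of G is meant to be the null set on which a subsequence
    converging in L^2 may diverge. *)
Lemma fatou_bound (F : nat -> T -> R) (f : T -> R) (G : set T) (C : \bar R) :
  (forall k, measurable_fun setT (F k)) -> measurable_fun setT f ->
  (forall k t, 0 <= F k t) -> (forall t, 0 <= f t) ->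
  measurable G -> mu (~` G) = 0%E ->
  (forall t, G t -> F k t @[k --> \oo] --> f t) ->
  (exists K, forall k, (K <= k)%N -> (\int[mu]_t (F k t)%:E <= C)%E) ->
  (\int[mu]_t (f t)%:E <= C)%E.
Proof.
move=> mF mf F0 f0 mG G0 Ff [K HK].
have mnG : measurable (~` G) by exact: measurableC.
rewrite (ge0_negligible_integral mnG)//; last 2 first.
- exact/measurable_EFinP.
- by move=> t _; rewrite lee_fin.
rewrite setTD setCK.
apply: (@le_trans _ _ (\int[mu]_(t in G) limn_einf (fun k => (F (k + K)%N t)%:E))%E).
  rewrite le_eqVlt; apply/orP; left; apply/eqP; apply: eq_integral => t /[!inE] Gt.
  have FKf : (F (k + K)%N t)%:E @[k --> \oo] --> (f t)%:E.
    apply: cvg_EFin; first exact: nearW.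
    by rewrite (cvg_shiftn K (fun k => F k t)); exact: Ff.
  by rewrite (cvg_limn_einf_sup FKf).1.
apply: le_trans (fatou mu mG _ _) _.
- by move=> k; apply: measurable_funTS; exact/measurable_EFinP.
- by move=> k t _; rewrite lee_fin.
rewrite limn_einf_lim; apply: lime_le; first exact: is_cvg_einfs.
apply: nearW => k; apply: (@le_trans _ _ (\int[mu]_(t in G) (F (k + K)%N t)%:E)%E).
  by apply: ereal_inf_lbound; exists k => /=.
apply: le_trans (HK (k + K)%N (leq_addl _ _)).
apply: ge0_subset_integral => //; first exact/measurable_EFinP.
by move=> t _; rewrite lee_fin.
Qed.

End fatou_bound.

Section simple_approximation.
Context d (T : measurableType d) (R : realType) (P : probability T R).
Context {E : normedModType R[i]}.

Lemma strongly_measurableB (f g : T -> E) :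
  strongly_measurable f -> strongly_measurable g ->
  strongly_measurable (fun t => f t - g t).
Proof.
move=> sf sg; under eq_fun do rewrite addrC -scaleN1r.
exact: strongly_measurableDZ.
Qed.

Lemma simple_strongly_measurable (s : T -> E) :
  simple_fun s -> strongly_measurable s.
Proof. by move=> ss; exists (fun=> s); split=> // t; exact: cvg_cst. Qed.

Lemma measurable_trunc_dist (f g : T -> E) :
  strongly_measurable f -> strongly_measurable g ->
  measurable_fun setT (fun t => Num.min 1 (rnorm (f t - g t))).
Proof.
move=> sf sg; apply: measurable_minr => //.
exact/strongly_measurable_rnorm/strongly_measurableB.
Qed.

(** Truncating the norm at 1 makes dominated convergence available without any
    integrability of f. *)
Lemma simple_approx (f : T -> E) (e : R) : strongly_measurable f -> 0 < e ->
  exists s, simple_fun s /\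
    (\int[P]_t (Num.min 1 (rnorm (s t - f t)))%:E <= e%:E)%E.
Proof.
move=> sf e0; have [s [ss sE]] := sf.
pose F n t := (Num.min 1 (rnorm (s n t - f t)))%:E.
have F0 n t : (0 <= F n t)%E by rewrite lee_fin le_min ler01 rnorm_ge0.
have mF n : measurable_fun setT (F n).
  apply/measurable_EFinP/measurable_trunc_dist => //.
  exact: simple_strongly_measurable.
have F_0 t : F n t @[n --> \oo] --> 0%E.
  apply/ereal_cvg0P => // a a0.
  have [N NH] := (cvg_rnormP _ _).1 (sE t) a a0.
  by exists N => n /NH /ltW sa; rewrite lee_fin ge_min sa orbT.
have i1 : P.-integrable setT (EFin \o cst (1 : R)).
  by apply: finite_measure_integrable_cst.
have aeF : {ae P, forall t, setT t -> F ^~ t @ \oo --> cst 0%E t}.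
  by apply: aeW => t _; exact: F_0.
have leF : {ae P, forall t n, setT t -> (`|F n t| <= (EFin \o cst (1%R : R)) t)%E}.
  by apply: aeW => t n _; rewrite gee0_abs// lee_fin ge_min lexx.
have [_ _] := dominated_convergence measurableT mF (measurable_cst _) aeF i1 leF.
rewrite integral0 => IF0.
have intF0 n : (0 <= \int[P]_t F n t)%E by exact: integral_ge0.
have [] := (ereal_cvg0P intF0).1 IF0 _ e0.
by move=> N /(_ N (leqnn N)) Ne; exists (s N).
Qed.

End simple_approximation.
Section L2_complete.
Context d (T : measurableType d) (R : realType) (P : probability T R).
Context {E : completeNormedModType R[i]}.
Implicit Types f g : T -> E.

Lemma int_sqnormB f g : int_sqnorm P setT (fun t => f t - g t) =
  int_sqnorm P setT (fun t => g t - f t).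
Proof. by apply: eq_integral => t _; rewrite -opprB rnormN. Qed.

Lemma simple_fun_restr (G : set T) (s : T -> E) : measurable G -> simple_fun s ->
  simple_fun (fun t => if `[< G t >] then s t else 0).
Proof.
move=> mG ss.
have sG : simple_fun (fun t => `[< G t >]).
  split; first exact: finite_finset.
  move=> [].
    rewrite (_ : _ @^-1` _ = G)//; apply/seteqP; split=> t /=.
      by move/asboolP.
    by move=> Gt; apply/asboolP.
  rewrite (_ : _ @^-1` _ = ~` G); first exact: measurableC.
  apply/seteqP; split=> t /=; first by move=> /asboolPn.
  by move=> Gt; apply/asboolPn.
exact: (simple_fun_comp (fun p => if p.2 then p.1 else 0) (simple_fun_pair ss sG)).
Qed.

(** Integrate the pointwise bound a <= e / 2 + a ^ 2 / (2 e). *)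
Lemma int_rnorm_le f (e : R) : strongly_measurable f -> 0 < e ->
  (int_sqnorm P setT f <= (e ^+ 2)%:E)%E ->
  (\int[P]_t (rnorm (f t))%:E <= e%:E)%E.
Proof.
move=> sf e0 fe.
have msq := measurable_sqnorm sf.
pose c := (2 * e)^-1; have c0 : 0 <= c by rewrite invr_ge0 mulr_ge0 ?ltW.
apply: (@le_trans _ _ (\int[P]_t ((e / 2)%:E + c%:E * (rnorm (f t) ^+ 2)%:E))%E).
  apply: ge0_le_integral => //.
  - by move=> t _; rewrite lee_fin rnorm_ge0.
  - exact/measurable_EFinP/strongly_measurable_rnorm.
  - by apply: emeasurable_funD => //; exact: measurable_funeM.
  move=> t _; rewrite -EFinM -EFinD lee_fin -subr_ge0.
  rewrite (_ : _ - _ = c * (rnorm (f t) - e) ^+ 2).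
    by apply: mulr_ge0 => //; exact: sqr_ge0.
  by rewrite /c; field; rewrite gt_eqF.
rewrite ge0_integralD//; last 3 first.
- by move=> t _; rewrite lee_fin divr_ge0 ?ltW.
- by move=> t _; rewrite mule_ge0 ?lee_fin ?sqr_ge0.
- exact: measurable_funeM.
rewrite integral_cst//.
rewrite [X in (_ * X + _)%E](_ : _ = 1%E) ?mule1; last exact: probability_setT.
rewrite ge0_integralZl_EFin//; last by move=> t _; rewrite lee_fin sqr_ge0.
apply: (@le_trans _ _ ((e / 2)%:E + c%:E * (e ^+ 2)%:E)%E).
  by apply: leeD => //; apply: lee_wpmul2l => //; rewrite lee_fin.
rewrite -EFinM -EFinD lee_fin le_eqVlt; apply/orP; left; apply/eqP.
by rewrite /c; field; rewrite gt_eqF.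
Qed.

(** A subsequence v converges almost everywhere, its increments being summable in
    L^1. Strong measurability of the limit asks for simple functions converging
    everywhere to it; they are simple approximations s k of v k, with summable
    errors in probability, set to 0 off the convergence set G. The L^2
    convergence follows by Fatou. *)
Lemma L2_complete (u : nat -> T -> E) :
  (forall n, strongly_measurable (u n)) ->
  (forall n, int_sqnorm P setT (u n) < +oo)%E ->
  (forall e : R, 0 < e -> exists N, forall m n, (N <= m)%N -> (N <= n)%N ->
    (int_sqnorm P setT (fun t => (u m t - u n t)%R) <= e%:E)%E) ->
  exists X, square_integrable P setT X /\
    int_sqnorm P setT (fun t => u n t - X t) @[n --> \oo] --> 0%E.
Proof.
move=> su fu Cu.
pose eta (k : nat) : R := 1 / (2 ^ k.+1)%:R.
have eta0 k : 0 < eta k by rewrite divr_gt0// ltr0n expn_gt0.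
have /choice[phi phiP] k : exists N, forall m n, (N <= m)%N -> (N <= n)%N ->
    (int_sqnorm P setT (fun t => (u m t - u n t)%R) <= (eta k ^+ 2)%:E)%E.
  by apply: Cu; rewrite exprn_gt0.
pose nk k := (k + \sum_(i < k.+1) phi i)%N.
have nk_id k : (k <= nk k)%N by rewrite leq_addr.
have nk_phi k : (phi k <= nk k)%N.
  by rewrite /nk big_ord_recr /= addnA leq_addl.
have nkS k : (nk k <= nk k.+1)%N.
  by rewrite /nk [X in (_ <= _ + X)%N]big_ord_recr leq_add ?leq_addr.
pose v k := u (nk k).
have sv k : strongly_measurable (v k) by exact: su.
have /choice[s sP] k := simple_approx P (sv k) (eta0 k).
(* On the set where the series of h converges, v is Cauchy and s - v tends to
   0. *)
pose h k t := rnorm (v k.+1 t - v k t) + Num.min 1 (rnorm (s k t - v k t)).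
have ss k : simple_fun (s k) := (sP k).1.
have m0 k t : 0 <= Num.min 1 (rnorm (s k t - v k t)).
  by rewrite le_min ler01 rnorm_ge0.
have h0 k t : (0 <= (h k t)%:E)%E by rewrite lee_fin addr_ge0 ?rnorm_ge0.
have mv k : measurable_fun setT (fun t => rnorm (v k.+1 t - v k t)).
  exact/strongly_measurable_rnorm/strongly_measurableB.
have mm k : measurable_fun setT (fun t => Num.min 1 (rnorm (s k t - v k t))).
  apply: measurable_trunc_dist => //; exact: simple_strongly_measurable.
have mh k : measurable_fun setT (fun t => (h k t)%:E).
  by apply/measurable_EFinP; exact: measurable_funD.
have ih k : (\int[P]_t (h k t)%:E <= (2 / (2 ^ k.+1)%:R)%:E)%E.
  rewrite /h; under eq_integral do rewrite EFinD.
  rewrite ge0_integralD//; last 4 first.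
  - by move=> t _; rewrite lee_fin rnorm_ge0.
  - exact/measurable_EFinP.
  - by move=> t _; rewrite lee_fin.
  - exact/measurable_EFinP.
  rewrite (_ : 2 / _ = eta k + eta k); last by rewrite /eta; ring.
  rewrite EFinD; apply: leeD; last exact: (sP k).2.
  apply: int_rnorm_le => //; first exact: strongly_measurableB.
  by apply: phiP; [exact: leq_trans (nkS k)|].
pose S t := (\sum_(k <oo) (h k t)%:E)%E.
have S0 t : (0 <= S t)%E by exact: nneseries_ge0.
have mS : measurable_fun setT S.
  by apply: ge0_emeasurable_sum => // k t _ _; exact: h0.
have iS : (\int[P]_t S t < +oo)%E.
  rewrite /S integral_nneseries//.
  apply: (@le_lt_trans _ _ 2%:E); last exact: ltry.
  apply: le_trans (epsilon_trick0 xpredT (ler0n R 2)).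
  by apply: lee_nneseries => [k _ _|k _]; [exact: integral_ge0|exact: ih].
pose G := [set t | (S t < +oo)%E].
have mG : measurable G.
  rewrite -[G]setTI; exact: emeasurable_fun_infty_o.
have G0 : P (~` G) = 0%E.
  have intS : P.-integrable setT S.
    apply/integrableP; split=> //.
    by under eq_integral do rewrite gee0_abs//.
  have [B [mB B0 sB]] := integrable_ae measurableT intS.
  apply: (subset_measure0 _ mB _ B0); first exact: measurableC.
  move=> t /= Gt; apply: sB => /= /(_ I) Sfin; apply: Gt.
  by rewrite /G /= -ge0_fin_numE.
have vcvg t : G t -> cvg (v k t @[k --> \oo]).
  move=> Gt; apply: rnorm_series_cvg; apply: le_lt_trans Gt.
  apply: lee_nneseries => [k _ _|k _]; first by rewrite lee_fin rnorm_ge0.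
  by rewrite lee_fin lerDl.
have scvg t : G t -> s k t @[k --> \oo] --> lim (v k t @[k --> \oo]).
  move=> Gt; apply/cvg_rnormP => e e0.
  have e20 : 0 < Num.min 1 (e / 2) by rewrite lt_min ltr01 divr_gt0.
  have [N NH] := nneseries_small (fun k => addr_ge0 (rnorm_ge0 _) (m0 k t)) Gt e20.
  have [M MH] := (cvg_rnormP _ _).1 (vcvg t Gt) (e / 2) (divr_gt0 e0 (ltr0n R 2)).
  exists (maxn N M) => n; rewrite geq_max => /andP[Nn Mn].
  rewrite -(subrKA (v n t)) (le_lt_trans (ler_rnormD _ _))//.
  rewrite [e]splitr ltrD//; last exact: MH.
  have := NH n.+1; rewrite big_nat_recr//= => hn.
  have : Num.min 1 (rnorm (s n t - v n t)) < Num.min 1 (e / 2).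
    apply: le_lt_trans hn; rewrite addrA lerDr addr_ge0 ?rnorm_ge0//.
    by apply: sumr_ge0 => k _; rewrite addr_ge0 ?rnorm_ge0.
  rewrite lt_min => /andP[]; have [x1|x1] := leP 1 (rnorm (s n t - v n t)).
    by rewrite ltxx.
  by [].
pose X t := if `[< G t >] then lim (v k t @[k --> \oo]) else 0.
have sX : strongly_measurable X.
  exists (fun k t => if `[< G t >] then s k t else 0); split=> [k|t].
    exact: simple_fun_restr.
  rewrite /X; case: asboolP => Gt; [exact: scvg|exact: cvg_cst].
have key (e : R) N : (forall m n, (N <= m)%N -> (N <= n)%N ->
    (int_sqnorm P setT (fun t => (u m t - u n t)%R) <= e%:E)%E) ->
  forall n, (N <= n)%N -> (int_sqnorm P setT (fun t => (u n t - X t)%R) <= e%:E)%E.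
  move=> NH n Nn.
  apply: (@fatou_bound _ _ _ P (fun k t => rnorm (u n t - v k t) ^+ 2) _ G) => //.
  - move=> k; apply/measurable_funX/strongly_measurable_rnorm.
    exact: strongly_measurableB.
  - apply/measurable_funX/strongly_measurable_rnorm.
    exact: strongly_measurableB.
  - by move=> k t; exact: sqr_ge0.
  - by move=> t; exact: sqr_ge0.
  - move=> t Gt; rewrite /X; case: asboolP => // _.
    have uv : rnorm (u n t - v k t) @[k --> \oo] -->
        rnorm (u n t - lim (v k t @[k --> \oo])).
      by apply: cvg_rnorm; apply: cvgB; [exact: cvg_cst|exact: vcvg].
    rewrite expr2; under eq_fun do rewrite expr2.
    exact: cvgM.
  - by exists N => k Nk; apply: NH => //; exact: leq_trans (nk_id k).
exists X; split; last first.
  apply/ereal_cvg0P => [n|e e0]; first exact: int_sqnorm_ge0.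
  by have [N NH] := Cu _ e0; exists N => n; exact: key.
split=> //; have [N NH] := Cu _ ltr01.
have := key _ _ NH N (leqnn N); rewrite int_sqnormB => XN.
rewrite (_ : X = fun t => u N t + (X t - u N t)); last first.
  by apply/funext => t; rewrite addrC subrK.
apply: le_lt_trans (int_sqnorm_le2D _ _ _) _ => //; first exact: strongly_measurableB.
by rewrite lte_add_pinfty// lte_mul_pinfty// (le_lt_trans XN)// ltry.
Qed.

End L2_complete.

(** * Semi-inner products *)

Section semi_inner_product.
Context {R : realType} {K : lmodType R[i]}.

(** The form may be degenerate: elements of L^2 are functions here, not classes. *)
Record semi_inner_product (dot : K -> K -> R[i]) : Prop := SemiInnerProduct {
  sip_linear : forall a x y z, dot (a *: x + y) z = a * dot x z + dot y z;
  sip_conj : forall x y, dot y x = conjc (dot x y);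
  sip_ge0 : forall x, 0 <= complex.Re (dot x x) }.

(** The squared modulus with values in R, where sums of energies live. *)
Definition sqmod (z : R[i]) : R := complex.Re z ^+ 2 + complex.Im z ^+ 2.

Lemma sqmod_ge0 z : 0 <= sqmod z.
Proof. by rewrite addr_ge0 ?sqr_ge0. Qed.

Variable dot : K -> K -> R[i].
Hypothesis dotP : semi_inner_product dot.
Implicit Types (x y : K) (k : nat -> K).

Lemma sip0l z : dot 0 z = 0.
Proof.
have := sip_linear dotP 0 0 0 z; rewrite scale0r addr0 mul0r add0r.
by have := sip_linear dotP 1 0 0 z; rewrite scale1r addr0 mul1r => /eqP;
  rewrite -subr_eq0 opprD addrA subrr sub0r oppr_eq0 => /eqP.
Qed.

Lemma sipDl x y z : dot (x + y) z = dot x z + dot y z.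
Proof. by have := sip_linear dotP 1 x y z; rewrite scale1r mul1r. Qed.

Lemma sipZl a x z : dot (a *: x) z = a * dot x z.
Proof. by have := sip_linear dotP a x 0 z; rewrite !addr0 sip0l addr0. Qed.

Lemma sipNl x z : dot (- x) z = - dot x z.
Proof. by rewrite -scaleN1r sipZl mulN1r. Qed.

Lemma sip_suml n (F : nat -> K) z :
  dot (\sum_(i < n) F i) z = \sum_(i < n) dot (F i) z.
Proof.
elim: n => [|n IHn]; first by rewrite !big_ord0 sip0l.
by rewrite !big_ord_recr /= sipDl IHn.
Qed.

Lemma Re_sip_sub y v : dot v v = 1 ->
  complex.Re (dot (y - dot y v *: v) (y - dot y v *: v)) =
  complex.Re (dot y y) - sqmod (dot y v).
Proof.
move=> vv; set a := dot y v.
have E1 : dot (y - a *: v) v = 0 by rewrite sipDl sipNl sipZl vv mulr1 subrr.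
rewrite sipDl sipNl sipZl (sip_conj dotP (y - a *: v) v) E1 rmorph0 mulr0 subr0.
rewrite (sip_conj dotP _ y) sipDl sipNl sipZl (sip_conj dotP y v) -/a.
move: (dot y y) a {E1} => [p q] [u w] /=; rewrite /sqmod /=; ring.
Qed.

Lemma sip_orthZ a x y : dot x y = 0 -> dot x (a *: y) = 0.
Proof.
move=> xy; rewrite (sip_conj dotP (a *: y)) sipZl (sip_conj dotP x) xy.
by rewrite rmorph0 mulr0 rmorph0.
Qed.

Lemma Re_sipD x y : complex.Re (dot (x + y) (x + y)) =
  complex.Re (dot x x) + complex.Re (dot y y) + 2 * complex.Re (dot x y).
Proof.
rewrite sipDl (sip_conj dotP (x + y) x) (sip_conj dotP (x + y) y) !sipDl.
rewrite (sip_conj dotP x y).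
move: (dot x x) (dot x y) (dot y y) => [a b] [c d] [e f] /=; ring.
Qed.

Lemma Re_sipZ a x : complex.Re (dot (a *: x) (a *: x)) =
  sqmod a * complex.Re (dot x x).
Proof.
rewrite sipZl (sip_conj dotP (a *: x) x) sipZl.
have /eqP : dot x x = conjc (dot x x) := sip_conj dotP x x.
move: (dot x x) a => [p q] [u v] /=; rewrite eq_complex /= => /andP[_ /eqP qq].
have -> : q = 0 by move: qq; lra.
by rewrite /sqmod /=; ring.
Qed.

Definition residual n k x := x - \sum_(j < n) dot x (k j) *: k j.

Lemma residualB n k x y : residual n k (x - y) = residual n k x - residual n k y.
Proof.
rewrite /residual; under eq_bigr do rewrite sipDl sipNl scalerBl.
rewrite sumrB !opprB addrACA [RHS]addrACA; congr (_ + _).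
by rewrite addrC.
Qed.

Definition orthonormal_seq k := forall i j, dot (k i) (k j) = (i == j)%:R.

Lemma residual_orth n k x j :
  (forall i j, (i < n)%N -> (j < n)%N -> dot (k i) (k j) = (i == j)%:R) ->
  (j < n)%N -> dot (residual n k x) (k j) = 0.
Proof.
move=> ok jn; rewrite sipDl sipNl (@sip_suml _ (fun i => dot x (k i) *: k i)).
rewrite (bigD1 (Ordinal jn))//= big1 ?addr0 ?sipZl ?ok// ?eqxx ?mulr1 ?subrr//.
by move=> i; rewrite -val_eqE /= => /negbTE ij; rewrite sipZl ok// ij mulr0.
Qed.

Lemma residualS n k x : (forall i, (i < n)%N -> dot (k i) (k n) = 0) ->
  residual n.+1 k x = residual n k x - dot (residual n k x) (k n) *: k n.
Proof.
move=> kn0; rewrite /residual big_ord_recr opprD addrA /=; congr (_ - _ *: _).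
rewrite sipDl sipNl (@sip_suml _ (fun i => dot x (k i) *: k i)).
by rewrite big1 ?subr0// => i _; rewrite sipZl kn0 ?mulr0.
Qed.

(** Each further vector takes the squared modulus of its coefficient off. *)
Lemma sip_residual n k x : orthonormal_seq k ->
  complex.Re (dot (residual n k x) (residual n k x)) =
  complex.Re (dot x x) - \sum_(j < n) sqmod (dot x (k j)).
Proof.
move=> ok; elim: n => [|n IHn].
  by rewrite /residual !big_ord0 !subr0.
have kn0 i : (i < n)%N -> dot (k i) (k n) = 0 by move=> ?; rewrite ok ltn_eqF.
rewrite residualS// Re_sip_sub ?ok ?eqxx// IHn big_ord_recr /= [in RHS]opprD [in RHS]addrA.
congr (_ - sqmod _); rewrite sipDl sipNl (@sip_suml _ (fun i => dot x (k i) *: k i)).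
by rewrite big1 ?subr0// => i _; rewrite sipZl kn0 ?mulr0.
Qed.

Lemma bessel n k x : orthonormal_seq k ->
  \sum_(j < n) sqmod (dot x (k j)) <= complex.Re (dot x x).
Proof. by move=> ok; rewrite -subr_ge0 -sip_residual// (sip_ge0 dotP). Qed.

Lemma orthonormal_pythagoras n k (a : nat -> R[i]) : orthonormal_seq k ->
  complex.Re (dot (\sum_(j < n) a j *: k j) (\sum_(j < n) a j *: k j)) =
  \sum_(j < n) sqmod (a j).
Proof.
move=> ok; elim: n => [|n IHn]; first by rewrite !big_ord0 sip0l.
rewrite !big_ord_recr /= Re_sipD IHn Re_sipZ ok eqxx.
rewrite (@sip_orthZ _ _ (k n)).
  by rewrite !mulr1 mulr0 addr0.
rewrite (@sip_suml _ (fun i => a i *: k i)) big1// => i _.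
by rewrite sipZl ok ltn_eqF// mulr0.
Qed.

End semi_inner_product.

(** * Gram-Schmidt in a separable Hilbert space *)

Section orthonormal_basis_exists.
Context {R : realType} (H : normedModType R[i]) (dot : {dot H for Num.conj}).
Hypothesis dotE : forall x : H, `|x| ^+ 2 = dot x x.

Lemma dot_semi_inner_product : semi_inner_product dot.
Proof.
split=> [a x y z|x y|x].
- by rewrite linearPl.
- by rewrite hermC expr0 mul1r.
- by have := dnorm_ge0 dot x; rewrite lecE /= => /andP[].
Qed.

Local Notation dotP := dot_semi_inner_product.

Lemma Re_dot_rnorm (x : H) : complex.Re (dot x x) = rnorm x ^+ 2.
Proof. by rewrite -dotE -rnormE -rmorphXn. Qed.

Lemma dot_norm_rnorm (x : H) : dot_norm dot x = rnorm x.
Proof. by rewrite /dot_norm Re_dot_rnorm sqrtr_sqr ger0_norm ?rnorm_ge0. Qed.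

Definition seq_residual (s : seq H) (x : H) : H :=
  x - \sum_(v <- s) dot x v *: v.

(** The normalized residual of a when it does not vanish, and of some other
    vector otherwise: in both cases a is in the span of the new vectors, and
    no vector of the dense sequence has to be skipped. *)
Definition gs_next (a : H) (s : seq H) : H :=
  let y := if seq_residual s a != 0 then a
           else xget 0 [set y | seq_residual s y != 0] in
  (rnorm (seq_residual s y))^-1%:C *: seq_residual s y.

Fixpoint gs_prefix (a : nat -> H) (n : nat) : seq H :=
  if n is m.+1 then gs_next (a m) (gs_prefix a m) :: gs_prefix a m else [::].

Definition gs (a : nat -> H) (n : nat) : H := gs_next (a n) (gs_prefix a n).

Lemma rnorm_eq0 (x : H) : (rnorm x == 0) = (x == 0).
Proof. by rewrite -(inj_eq (@complexI R)) rnormE normr_eq0. Qed.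

Lemma seq_residual_gs a n x :
  seq_residual (gs_prefix a n) x = residual dot n (gs a) x.
Proof.
rewrite /seq_residual /residual; congr (_ - _).
elim: n => [|n IHn]; first by rewrite big_nil big_ord0.
by rewrite /= big_cons big_ord_recr /= -IHn addrC.
Qed.

Hypothesis infH : infinite_dimensional H.

(** In infinite dimension some vector has a nonzero residual. *)
Lemma gs_nextE a n : exists y, [/\ residual dot n (gs a) y != 0,
  gs a n = (rnorm (residual dot n (gs a) y))^-1%:C *: residual dot n (gs a) y &
  residual dot n (gs a) (a n) != 0 -> y = a n].
Proof.
have -> : gs a n = gs_next (a n) (gs_prefix a n) by [].
rewrite /gs_next; case: ifPn => [r0|r0].
  by exists (a n); rewrite -!seq_residual_gs.
move: r0; rewrite negbK seq_residual_gs => r0.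
have [x xH] := infH (fun i : 'I_n => gs a i).
have ex : exists y, seq_residual (gs_prefix a n) y != 0.
  by exists x; rewrite seq_residual_gs subr_eq0 xH.
have yr := xgetPex 0 ex.
exists (xget 0 [set y | seq_residual (gs_prefix a n) y != 0]).
rewrite -!seq_residual_gs; split=> //.
by rewrite seq_residual_gs r0.
Qed.

Lemma gs_orthonormal a : orthonormal_seq dot (gs a).
Proof.
suff Hn n i j : (i < n)%N -> (j < n)%N -> dot (gs a i) (gs a j) = (i == j)%:R.
  by move=> i j; apply: (Hn (maxn i j).+1); rewrite ltnS ?leq_maxl ?leq_maxr.
elim: n i j => // n IHn i j.
have [y [r0 gE _]] := gs_nextE a n.
have orth l : (l < n)%N -> dot (gs a n) (gs a l) = 0.
  by move=> ln; rewrite gE (sipZl dotP) (residual_orth dotP)// mulr0.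
rewrite !ltnS [(i <= n)%N]leq_eqVlt [(j <= n)%N]leq_eqVlt.
move=> /predU1P[->|im] /predU1P[->|jm]; last exact: IHn.
- rewrite eqxx gE; apply/eqP; rewrite -dotE normrZ -rnormE.
  rewrite ger0_norm ?ler0c ?invr_ge0 ?rnorm_ge0// -rmorphM /= mulVf ?rnorm_eq0//.
  by rewrite rmorph1 expr1n.
- by rewrite orth// gtn_eqF.
- by rewrite (sip_conj dotP (gs a n)) orth// rmorph0 ltn_eqF.
Qed.

(** The vector gs a m makes the residual of a m vanish, and it stays 0. *)
Lemma gs_span a m n : (m < n)%N -> residual dot n (gs a) (a m) = 0.
Proof.
move=> /subnK <-; have oe := gs_orthonormal a.
have kn0 l i : (i < l)%N -> dot (gs a i) (gs a l) = 0.
  by move=> il; rewrite oe ltn_eqF.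
elim: (n - m.+1)%N => [|k IHk]; last first.
  rewrite addSn (residualS dotP); last by move=> i; exact: kn0.
  by rewrite IHk (sip0l dotP) scale0r subr0.
rewrite add0n (residualS dotP); last by move=> i; exact: kn0.
have [y [r0 gE yE]] := gs_nextE a m.
have [->|rn0] := eqVneq (residual dot m (gs a) (a m)) 0.
  by rewrite (sip0l dotP) scale0r subr0.
rewrite (yE rn0) in gE; set r := residual _ _ _ _ in gE rn0 *.
rewrite gE (sip_conj dotP _ r) (sipZl dotP) -dotE -rnormE.
rewrite -rmorphXn -rmorphM conjc_real scalerA -rmorphM /=.
rewrite (_ : _ * _ = 1) ?scale1r ?subrr//.
by field; rewrite rnorm_eq0.
Qed.

Hypothesis sepH : separable H.

(** Residuals do not increase the norm and kill the vectors of the dense sequence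
    from some rank on, so they tend to 0 at every vector. *)
Lemma orthonormal_basis_exists : exists k, orthonormal_basis dot k.
Proof.
have [A [cA dA]] := sepH.
have A0 : A !=set0.
  have := dA setT; rewrite setTI; apply; last exact: openT.
  by exists 0.
have [a aA] : exists a : nat -> H, A `<=` range a.
  move: cA => /pfcard_geP[A_0|[f]]; first by move: A0; rewrite A_0 => -[].
  exists f => x Ax; have [n _ <-] := 'surj_f Ax.
  by exists n.
exists (gs a); split; first exact: gs_orthonormal.
move=> x; apply/cvgrPdist_lt => e e0.
have e0C : 0 < e%:C :> R[i] by rewrite ltcR.
have [z [/= xb /aA [m _ am]]] : (ball x e%:C `&` A) !=set0.
  apply: dA; first by exists x; exact: ballxx.
  exact: ball_open.
exists m.+1 => // n /= mn.
rewrite sub0r normrN dot_norm_rnorm ger0_norm ?rnorm_ge0//.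
rewrite -/(residual dot n (gs a) x).
have -> : residual dot n (gs a) x = residual dot n (gs a) (x - a m).
  by rewrite (residualB dotP) (gs_span a mn) subr0.
apply: (@le_lt_trans _ _ (rnorm (x - a m))); last first.
  by move: xb; rewrite -am -ball_normE /ball_ /= -rnormE ltcR.
rewrite -ler_sqr ?nnegrE ?rnorm_ge0// -!Re_dot_rnorm.
rewrite (sip_residual dotP _ _ (gs_orthonormal a)) gerBl.
by apply: sumr_ge0 => j _; exact: sqmod_ge0.
Qed.

End orthonormal_basis_exists.

(** * The semi-inner product of L^2(D; H) *)

Section L2_inner_product.
Context d (T : measurableType d) (R : realType).
Variables (mu : {measure set T -> \bar R}) (D : set T) (mD : measurable D).
Variables (H : normedModType R[i]) (dot : {dot H for Num.conj}).
Hypothesis dotE : forall x : H, `|x| ^+ 2 = dot x x.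
Local Notation L2 := (L2fun mu mD H).
Implicit Types f g h : L2.
Local Notation dotP := (dot_semi_inner_product dot).

Lemma L2fun_square_integrable f : square_integrable mu D f.
Proof. by have := valP f => /asboolP. Qed.

(** Polarization gives the measurability of the scalar products from that of the
    norms. *)
Lemma Re_dot_polar (x y : H) :
  complex.Re (dot x y) = (rnorm (x + y) ^+ 2 - rnorm x ^+ 2 - rnorm y ^+ 2) / 2.
Proof. by rewrite -!(Re_dot_rnorm dotE) (Re_sipD dotP); field. Qed.

Lemma Im_dot_Re (x y : H) : complex.Im (dot x y) = complex.Re (dot x ('i *: y)).
Proof.
rewrite (sip_conj dotP ('i *: y)) (sipZl dotP) (sip_conj dotP x).
by case: (dot x y) => a b /=; ring.
Qed.

Lemma Re_dot_le (x y : H) :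
  `|complex.Re (dot x y)| <= rnorm x ^+ 2 + rnorm y ^+ 2.
Proof.
rewrite Re_dot_polar ler_norml; apply/andP; split.
  have := sqr_ge0 (rnorm (x + y)).
  have := sqr_ge0 (rnorm x); have := sqr_ge0 (rnorm y); lra.
have := sqr_ler_rnormD x y; have := sqr_ge0 (rnorm x); have := sqr_ge0 (rnorm y).
lra.
Qed.

Lemma rnormi (x : H) : rnorm ('i *: x) = rnorm x.
Proof. by rewrite rnormZ normc_def /= expr0n expr1n add0r sqrtr1 mul1r. Qed.

Lemma strongly_measurableZ (a : R[i]) (f : T -> H) : strongly_measurable f ->
  strongly_measurable (fun t => a *: f t).
Proof.
move=> sf; under eq_fun do rewrite -[_ *: _]addr0.
by apply: strongly_measurableDZ => //; exact: strongly_measurable_cst.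
Qed.

Lemma integrable_sqnorm (f : T -> H) : square_integrable mu D f ->
  mu.-integrable D (EFin \o (fun t => rnorm (f t) ^+ 2)).
Proof.
move=> [sf ff]; apply/integrableP; split.
  by apply: measurable_funTS; exact: measurable_sqnorm.
by under eq_integral do rewrite gee0_abs ?lee_fin ?sqr_ge0//.
Qed.

Lemma integrable_Re_dot (f g : T -> H) :
  square_integrable mu D f -> square_integrable mu D g ->
  mu.-integrable D (EFin \o (fun t => complex.Re (dot (f t) (g t)))).
Proof.
move=> f2 g2; have [sf _] := f2; have [sg _] := g2.
apply: (@le_integrable _ _ _ mu _ mD _
  (fun t => (rnorm (f t) ^+ 2 + rnorm (g t) ^+ 2)%:E)).
- apply: measurable_funTS; apply/measurable_EFinP.
  have -> : (fun t => complex.Re (dot (f t) (g t))) = (fun t =>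
     (rnorm (f t + g t) ^+ 2 - rnorm (f t) ^+ 2 - rnorm (g t) ^+ 2) / 2).
    by apply/funext => t; exact: Re_dot_polar.
  apply: measurable_funM => //; apply: measurable_funB; first apply: measurable_funB;
    apply: measurable_funX; apply: strongly_measurable_rnorm => //.
  by under eq_fun do rewrite -[f _]scale1r; exact: strongly_measurableDZ.
- move=> t _; rewrite lee_fin (le_trans (Re_dot_le _ _))//.
  by rewrite ler_norm.
- under eq_fun do rewrite EFinD.
  by apply: integrableD => //; exact: integrable_sqnorm.
Qed.

Lemma integrable_Im_dot (f g : T -> H) :
  square_integrable mu D f -> square_integrable mu D g ->
  mu.-integrable D (EFin \o (fun t => complex.Im (dot (f t) (g t)))).
Proof.
move=> f2 [sg gg].
under eq_fun do rewrite /= Im_dot_Re.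
apply: (@integrable_Re_dot f (fun t => 'i *: g t)) => //; split.
  exact: strongly_measurableZ.
by rewrite /int_sqnorm; under eq_integral do rewrite rnormi.
Qed.

Lemma L2dot_semi_inner_product : semi_inner_product (L2dot dot : L2 -> L2 -> R[i]).
Proof.
have sq := L2fun_square_integrable.
split.
- move=> a f g h; rewrite /L2dot /=.
  have E t : dot ((a *: f + g : L2) t) (h t) = a * dot (f t) (h t) + dot (g t) (h t).
    exact: (sip_linear dotP).
  have iRf := integrable_Re_dot (sq f) (sq h).
  have iIf := integrable_Im_dot (sq f) (sq h).
  have iRg := integrable_Re_dot (sq g) (sq h).
  have iIg := integrable_Im_dot (sq g) (sq h).
  case: a E => p q E.
  under eq_Rintegral => t _.
    rewrite E (_ : complex.Re _ = (p * complex.Re (dot (f t) (h t)) +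
      (- q) * complex.Im (dot (f t) (h t))) + complex.Re (dot (g t) (h t))); last first.
      by case: (dot (f t) (h t)) => u v; case: (dot (g t) (h t)) => u' v' /=; ring.
    over.
  under [X in _ +i* X = _]eq_Rintegral => t _.
    rewrite E (_ : complex.Im _ = (p * complex.Im (dot (f t) (h t)) +
      q * complex.Re (dot (f t) (h t))) + complex.Im (dot (g t) (h t))); last first.
      by case: (dot (f t) (h t)) => u v; case: (dot (g t) (h t)) => u' v' /=; ring.
    over.
  have iZ (r : R) (F : T -> R) : mu.-integrable D (EFin \o F) ->
      mu.-integrable D (EFin \o (fun t => r * F t)).
    move=> iF; rewrite (_ : _ \o _ = (fun t => r%:E * (F t)%:E)%E); last first.
      by apply/funext => t /=; rewrite EFinM.
    exact: integrableZl.
  have iD (F G : T -> R) : mu.-integrable D (EFin \o F) -> mu.-integrable D (EFin \o G) ->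
      mu.-integrable D (EFin \o (fun t => F t + G t)).
    move=> iF iG; rewrite (_ : _ \o _ = (fun t => (F t)%:E + (G t)%:E)%E); last first.
      by apply/funext => t /=; rewrite EFinD.
    exact: integrableD.
  rewrite !RintegralD//; [|exact: iZ|exact: iZ|by apply: iD; exact: iZ|
    exact: iZ|exact: iZ|by apply: iD; exact: iZ].
  rewrite !RintegralZl//.
  by apply/eqP; rewrite eq_complex /=; apply/andP; split; apply/eqP; ring.
- move=> f g; rewrite /L2dot /=.
  have E t : dot (g t) (f t) = conjc (dot (f t) (g t)) := sip_conj dotP _ _.
  under eq_Rintegral do rewrite E.
  under [X in _ +i* X = _]eq_Rintegral do rewrite E.
  apply/eqP; rewrite eq_complex /=; apply/andP; split; apply/eqP.
    by apply: eq_Rintegral => t _; case: (dot _ _).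
  rewrite -mulN1r -RintegralZl//; last exact: integrable_Im_dot.
  by apply: eq_Rintegral => t _; case: (dot _ _) => u v /=; rewrite mulN1r.
- by move=> f; apply: Rintegral_ge0 => t _; exact: (sip_ge0 dotP).
Qed.

Lemma Re_L2dot f : (complex.Re (L2dot dot f f))%:E = int_sqnorm mu D f.
Proof.
have [_ ff] := L2fun_square_integrable f.
rewrite /L2dot /= /Rintegral fineK; last first.
  under eq_integral do rewrite Re_dot_rnorm//.
  by rewrite ge0_fin_numE// int_sqnorm_ge0.
by apply: eq_integral => t _; rewrite Re_dot_rnorm.
Qed.

End L2_inner_product.

(** * Convergence of Gaussian series *)

Section gaussian_series.
Context d (Omega : measurableType d) (R : realType) (P : probability Omega R).
Variable gam : nat -> {RV P >-> R}.
Hypothesis gamG : gaussian_sequence gam.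
Context {E : completeNormedModType R[i]}.
Implicit Types (x : nat -> E) (X : Omega -> E).
Local Notation energy := (energy gam).

(** The beginning is replaced by 0, so that the Gaussian variables keep their
    indices. *)
Definition tail (V : nmodType) (m : nat) (x : nat -> V) : nat -> V :=
  fun n => if (n < m)%N then 0 else x n.

Lemma psum_tail m n x w : (m <= n)%N ->
  gauss_psum gam (tail m x) n w = gauss_psum gam x n w - gauss_psum gam x m w.
Proof.
move=> mn; rewrite /gauss_psum.
rewrite -!(big_mkord xpredT (fun k => (gam k w)%:C *: x k)).
rewrite -(big_mkord xpredT (fun k => (gam k w)%:C *: tail m x k)).
rewrite [in RHS](big_cat_nat (leq0n m) mn)/= addrC addrK.
rewrite (big_cat_nat (leq0n m) mn)/= big1_seq ?add0r.
  apply: eq_big_nat => k /andP[mk _].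
  by rewrite /tail ltnNge mk.
by move=> k; rewrite mem_index_iota /= => km; rewrite /tail km scaler0.
Qed.

Lemma gauss_sumP x : gauss_cvg gam x -> gauss_sum_to gam x (gauss_sum gam x).
Proof. by move=> cx; have [] := xgetPex (fun=> 0 : E) cx. Qed.

(** The energy increases with n and the partial sums converge in L^2; the
    factor 2 is that of |u + v|^2 <= 2 |u|^2 + 2 |v|^2. *)
Lemma energy_le_sum n x X : gauss_sum_to gam x X ->
  (energy n x <= 2%:E * int_sqnorm P setT X)%E.
Proof.
move=> [[sX fX] SX]; apply/lee_addgt0Pr => e e0.
have S0 k : (0 <= int_sqnorm P setT (fun w => (gauss_psum gam x k w - X w)%R))%E.
  exact: int_sqnorm_ge0.
have e20 : 0 < e / 2 by rewrite divr_gt0.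
have [N NH] := (ereal_cvg0P S0).1 SX _ e20.
apply: le_trans (energy_le gamG x (leq_maxl n N)) _.
rewrite energyE (_ : gauss_psum _ _ _ = fun w => X w +
    (gauss_psum gam x (maxn n N) w - X w)); last first.
  by apply/funext => w; rewrite addrC subrK.
have sS := strongly_measurable_psum gam (maxn n N) x.
apply: le_trans (int_sqnorm_le2D _ sX (strongly_measurableB sS sX)) _.
apply: leeD => //; rewrite (_ : e = 2 * (e / 2)) ?EFinM; last by field.
by apply: lee_wpmul2l => //; apply: NH; exact: leq_maxr.
Qed.

Lemma energy_tail_small x X : gauss_sum_to gam x X ->
  forall e : R, 0 < e -> exists N, forall n, (energy n (tail N x) <= e%:E)%E.
Proof.
move=> [[sX fX] SX] e e0.
have S0 k : (0 <= int_sqnorm P setT (fun w => (gauss_psum gam x k w - X w)%R))%E.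
  exact: int_sqnorm_ge0.
have e40 : 0 < e / 4 by rewrite divr_gt0.
have [N NH] := (ereal_cvg0P S0).1 SX _ e40.
exists N => n.
apply: le_trans (energy_le gamG (tail N x) (leq_maxl n N)) _.
have sS m := strongly_measurable_psum gam m x.
rewrite energyE (_ : gauss_psum _ _ _ = fun w =>
    (gauss_psum gam x (maxn n N) w - X w) + (X w - gauss_psum gam x N w)); last first.
  by apply/funext => w; rewrite psum_tail ?leq_maxr// subrKA.
apply: le_trans (int_sqnorm_le2D _ (strongly_measurableB (sS _) sX)
  (strongly_measurableB sX (sS _))) _.
rewrite [X in (_ + _ * X)%E]int_sqnormB.
rewrite (_ : e%:E = 2%:E * (e / 4)%:E + 2%:E * (e / 4)%:E)%E; last first.
  by rewrite -EFinM -EFinD; congr (_%:E); field.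
by apply: leeD; apply: lee_wpmul2l => //; apply: NH; rewrite ?leq_maxr.
Qed.

Lemma gauss_cvg_cauchy x : (forall n, energy n x < +oo)%E ->
  (forall e : R, 0 < e -> exists N, forall m n, (N <= m <= n)%N ->
    (energy n (tail m x) <= e%:E)%E) ->
  gauss_cvg gam x.
Proof.
move=> fx cx.
have sS m := strongly_measurable_psum gam m x.
have [|X [X2 XS]] := @L2_complete _ _ _ P E (gauss_psum gam x) sS fx; last by exists X.
move=> e e0; have [N NH] := cx e e0; exists N => m n Nm Nn.
wlog mn : m n Nm Nn / (m <= n)%N.
  move=> H; have [mn|/ltnW nm] := leqP m n; first exact: H.
  by rewrite int_sqnormB; exact: H.
rewrite int_sqnormB.
rewrite (_ : (fun _ => _) = gauss_psum gam (tail m x) n); last first.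
  by apply/funext => w; rewrite psum_tail.
by apply: NH; rewrite Nm.
Qed.

Lemma gauss_sqnorm_le x (C : \bar R) : gauss_cvg gam x ->
  (forall n, energy n x <= C)%E -> (gauss_sqnorm gam x <= 2%:E * C)%E.
Proof.
move=> /gauss_sumP[[sX fX] SX] xC; set X := gauss_sum gam x in sX fX SX *.
apply/lee_addgt0Pr => e e0.
have S0 k : (0 <= int_sqnorm P setT (fun w => (gauss_psum gam x k w - X w)%R))%E.
  exact: int_sqnorm_ge0.
have e20 : 0 < e / 2 by rewrite divr_gt0.
have [N NH] := (ereal_cvg0P S0).1 SX _ e20.
have sS := strongly_measurable_psum gam N x.
rewrite /gauss_sqnorm -/X (_ : X = fun w => gauss_psum gam x N w +
    (X w - gauss_psum gam x N w)); last first.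
  by apply/funext => w; rewrite addrC subrK.
apply: le_trans (int_sqnorm_le2D _ sS (strongly_measurableB sX sS)) _.
apply: leeD; first by apply: lee_wpmul2l => //; exact: xC.
rewrite (_ : e = 2 * (e / 2)) ?EFinM; last by field.
by apply: lee_wpmul2l => //; rewrite int_sqnormB; exact: NH.
Qed.

End gaussian_series.

(** * The ideal property *)

Section cauchy_schwarz.
Context {R : realFieldType}.

Lemma sum_cauchy_schwarz n (t r : nat -> R) :
  (\sum_(i < n) t i * r i) ^+ 2 <= (\sum_(i < n) r i ^+ 2) * (\sum_(i < n) t i ^+ 2).
Proof.
set S := \sum_(i < n) t i * r i; set A := \sum_(i < n) t i ^+ 2.
set B := \sum_(i < n) r i ^+ 2.
have A0 : 0 <= A by apply: sumr_ge0 => i _; exact: sqr_ge0.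
have [A_0|A_0] := eqVneq A 0.
  have t0 (i : 'I_n) : t i = 0.
    have /eqP := A_0; rewrite psumr_eq0; last by move=> j _; exact: sqr_ge0.
    by move=> /allP/(_ i (mem_index_enum _)); rewrite sqrf_eq0 => /eqP.
  rewrite A_0 mulr0 /S big1 ?expr0n// => i _; by rewrite t0 mul0r.
have A_gt0 : 0 < A by rewrite lt_neqAle eq_sym A_0.
rewrite -(ler_pM2l A_gt0) -subr_ge0.
suff -> : A * (B * A) - A * S ^+ 2 = \sum_(i < n) (A * r i - S * t i) ^+ 2.
  by apply: sumr_ge0 => i _; exact: sqr_ge0.
rewrite (eq_bigr (fun i : 'I_n => A ^+ 2 * r i ^+ 2 - 2 * A * S * (t i * r i) +
    S ^+ 2 * t i ^+ 2)); last by move=> i _; ring.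
by rewrite big_split /= sumrB -!mulr_sumr -/A -/B -/S; ring.
Qed.

End cauchy_schwarz.

Section ideal_property.
Context d (Omega : measurableType d) (R : realType) (P : probability Omega R).
Variable gam : nat -> {RV P >-> R}.
Hypothesis gamG : gaussian_sequence gam.
Context {E : completeNormedModType R[i]}.
Variables (K : lmodType R[i]) (dot : K -> K -> R[i]).
Hypothesis dotP : semi_inner_product dot.
Variable Phi : K -> E.
Hypothesis PhiB : bounded_linear dot Phi.
Variable k : nat -> K.
Hypothesis kB : orthonormal_basis dot k.
Hypothesis kC : gauss_cvg gam (Phi \o k).
Local Notation energy := (energy gam).

(** The operator sending the n-th unit vector to f n has norm at most c on real
    sequences. *)
Definition real_bessel (c : R) (f : nat -> K) := forall N (t : nat -> R),
  complex.Re (dot (\sum_(n < N) (t n)%:C *: f n) (\sum_(n < N) (t n)%:C *: f n)) <=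
  c ^+ 2 * \sum_(n < N) t n ^+ 2.

Lemma real_bessel_tail c f m : 0 < c -> real_bessel c f -> real_bessel c (tail m f).
Proof.
move=> c0 bf N t.
rewrite (_ : \sum_(n < N) _ = \sum_(n < N) (tail m t n)%:C *: f n); last first.
  by apply: eq_bigr => n _; rewrite /tail; case: ifP; rewrite ?scaler0 ?scale0r.
apply: le_trans (bf N _) _; rewrite ler_pM2l ?exprn_gt0//.
apply: ler_sum => n _; rewrite /tail; case: ifP => // _.
by rewrite expr0n sqr_ge0.
Qed.

Let coef (f : nat -> K) n l := dot (f n) (k l).
Let proj (f : nat -> K) M n : E := \sum_(l < M) coef f n l *: Phi (k l).

Let coef_sqmod f N (t : nat -> R) l :
  (\sum_(n < N) t n * complex.Re (coef f n l)) ^+ 2 +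
  (\sum_(n < N) t n * complex.Im (coef f n l)) ^+ 2 =
  sqmod (dot (\sum_(n < N) (t n)%:C *: f n) (k l)).
Proof.
rewrite (sip_suml dotP N (fun n => (t n)%:C *: f n)) /sqmod !raddf_sum /=.
by congr (_ ^+ 2 + _ ^+ 2); apply: eq_bigr => n _; rewrite (sipZl dotP) /coef;
  case: (dot _ _) => u v /=; ring.
Qed.

Let coef_contraction c f N M (t : nat -> R) : real_bessel c f ->
  \sum_(l < M) ((\sum_(n < N) t n * complex.Re (coef f n l)) ^+ 2 +
    (\sum_(n < N) t n * complex.Im (coef f n l)) ^+ 2) <=
  c ^+ 2 * \sum_(n < N) t n ^+ 2.
Proof.
move=> bf; under eq_bigr do rewrite coef_sqmod.
apply: le_trans (bf N t).
by apply: (bessel dotP); exact: kB.1.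
Qed.

Let Phi0 : Phi 0 = 0.
Proof.
have := PhiB.1 1 0 0; rewrite !scale1r addr0 => Phi00.
by apply: (addrI (Phi 0)); rewrite addr0 -Phi00.
Qed.

Let Phi_cvg f n : proj f M n @[M --> \oo] --> Phi (f n).
Proof.
have [linPhi [B PhiM]] := PhiB.
have PhiZ a y : Phi (a *: y) = a *: Phi y.
  by rewrite -[a *: y]addr0 linPhi Phi0 addr0.
have PhiD y z : Phi (y + z) = Phi y + Phi z.
  by rewrite -[y]scale1r linPhi !scale1r.
have PhiS M (a : nat -> R[i]) :
    Phi (\sum_(l < M) a l *: k l) = \sum_(l < M) a l *: Phi (k l).
  elim: M => [|M IHM]; first by rewrite !big_ord0.
  by rewrite !big_ord_recr /= PhiD PhiZ IHM.
have B1 : 0 < `|B| + 1 by rewrite ltr_wpDl.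
apply/cvg_rnormP => e e0.
have /cvgrPdist_lt/(_ _ (divr_gt0 e0 B1))[N _ NH] := kB.2 (f n).
exists N => M NM; have := NH M NM; rewrite /= sub0r normrN.
rewrite ger0_norm ?sqrtr_ge0// => rM.
rewrite -rnormN opprB /proj -(PhiS M (coef f n)) -scaleN1r -PhiZ -PhiD scaleN1r.
apply: le_lt_trans (PhiM _) _.
apply: (@le_lt_trans _ _ ((`|B| + 1) * dot_norm dot (f n - \sum_(l < M) coef f n l *: k l))).
  rewrite ler_wpM2r ?sqrtr_ge0// (le_trans (ler_norm B))// lerDl//.
by rewrite mulrC -ltr_pdivlMr.
Qed.

(** At each point of Omega the finite Gaussian sums of the projections converge. *)
Let energy_fatou f N (C : \bar R) :
  (exists M0, forall M, (M0 <= M)%N -> (energy N (proj f M) <= C)%E) ->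
  (energy N (Phi \o f) <= C)%E.
Proof.
move=> HC; rewrite energyE /int_sqnorm.
have mS y : measurable_fun setT (fun w => rnorm (gauss_psum gam y N w) ^+ 2).
  by apply: measurable_funX; apply/strongly_measurable_rnorm/strongly_measurable_psum.
apply: (@fatou_bound _ _ _ P (fun M w => rnorm (gauss_psum gam (proj f M) N w) ^+ 2)
  _ setT) => //.
- by move=> M w; exact: sqr_ge0.
- by move=> w; exact: sqr_ge0.
- by rewrite setCT measure0.
- move=> w _.
  have pc : rnorm (gauss_psum gam (proj f M) N w) @[M --> \oo] -->
      rnorm (gauss_psum gam (Phi \o f) N w).
    apply: cvg_rnorm; elim: (N) => [|n IHn].
      rewrite /gauss_psum big_ord0; under eq_fun do rewrite big_ord0.
      exact: cvg_cst.
    rewrite psumS; under eq_fun do rewrite psumS.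
    by apply: cvgD => //; apply: cvgZr; exact: Phi_cvg.
  by rewrite expr2; under eq_fun do rewrite expr2; exact: cvgM.
Qed.

(** The coefficients of f in the basis k form a matrix of norm at most c: this is
    Bessel's inequality for k combined with the bound on f. *)
Lemma energy_ideal c f N : 0 < c -> real_bessel c f ->
  (energy N (Phi \o f) <= (8 * c ^+ 2)%:E * gauss_sqnorm gam (Phi \o k))%E.
Proof.
move=> c0 bf; apply: energy_fatou; exists 0%N => M _.
apply: le_trans (energy_complex_contraction gamG (Phi \o k) c0 _) _.
  by move=> t; exact: coef_contraction.
rewrite (_ : 8 * c ^+ 2 = 4 * c ^+ 2 * 2); last by ring.
rewrite [X in (_ <= X * _)%E]EFinM -muleA; apply: lee_wpmul2l.
  by rewrite lee_fin mulr_ge0// sqr_ge0.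
exact/(energy_le_sum gamG)/gauss_sumP.
Qed.

Let gauss_fin : (gauss_sqnorm gam (Phi \o k) < +oo)%E.
Proof. by have [[]] := gauss_sumP kC. Qed.

(** Test the bound on f with t the real or imaginary part of the column itself. *)
Let coef_column c f N l : 0 < c -> real_bessel c f ->
  \sum_(n < N) sqmod (coef f n l) <= 2 * c ^+ 2.
Proof.
move=> c0 bf.
have key (t : nat -> R) : (forall n, t n = complex.Re (coef f n l)) \/
    (forall n, t n = complex.Im (coef f n l)) -> \sum_(n < N) t n ^+ 2 <= c ^+ 2.
  move=> tE; set T := \sum_(n < N) t n ^+ 2.
  have T0 : 0 <= T by apply: sumr_ge0 => n _; exact: sqr_ge0.
  have : T ^+ 2 <= c ^+ 2 * T.
    apply: le_trans (coef_contraction N l.+1 t bf).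
    rewrite big_ord_recr /= ler_wpDl ?sumr_ge0//.
      by move=> j _; rewrite addr_ge0 ?sqr_ge0.
    case: tE => tE.
      rewrite (_ : \sum_(n < N) t n * complex.Re _ = T) ?lerDl ?sqr_ge0//.
      by apply: eq_bigr => n _; rewrite -tE expr2.
    rewrite (_ : \sum_(n < N) t n * complex.Im _ = T) ?lerDr ?sqr_ge0//.
    by apply: eq_bigr => n _; rewrite -tE expr2.
  have [->|Tn0] := eqVneq T 0; first by rewrite sqr_ge0.
  by rewrite expr2 ler_pM2r// lt_neqAle eq_sym Tn0.
rewrite /sqmod big_split /= mulr_natl mulr2n lerD//.
  by apply: (key (fun n => complex.Re (coef f n l))); left.
by apply: (key (fun n => complex.Im (coef f n l))); right.
Qed.

(** The first J columns are square-summable, so by Cauchy-Schwarz the operator norm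
    of their rows beyond m tends to 0. *)
Let energy_hs_tail c f J (e : R) : 0 < c -> real_bessel c f -> 0 < e ->
  exists N0, forall m N, (N0 <= m)%N -> (energy N (proj (tail m f) J) <= e%:E)%E.
Proof.
move=> c0 bf e0.
pose S := fine (gauss_sqnorm gam (Phi \o k)).
have SE : gauss_sqnorm gam (Phi \o k) = S%:E.
  by rewrite fineK// ge0_fin_numE// int_sqnorm_ge0.
have S0 : 0 <= S by rewrite -lee_fin -SE int_sqnorm_ge0.
pose del : R := e / (8 * S + 1).
have S8 : 0 < 8 * S + 1 by rewrite ltr_wpDl// mulr_ge0.
have del0 : 0 < del by rewrite divr_gt0.
pose b n := \sum_(l < J) sqmod (coef f n l).
have b0 n : 0 <= b n by apply: sumr_ge0 => l _; exact: sqmod_ge0.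
have bS : (\sum_(n <oo) (b n)%:E < +oo)%E.
  apply: (@le_lt_trans _ _ (\sum_(l < J) (2 * c ^+ 2))%:E); last exact: ltry.
  apply: lime_le.
    by apply: is_cvg_nneseries => n _ _; rewrite lee_fin.
  apply: nearW => N; rewrite sumEFin lee_fin big_mkord exchange_big /=.
  by apply: ler_sum => l _; exact: coef_column.
have [N0 N0H] := nneseries_small b0 bS del0.
exists N0 => m N N0m.
have sdel0 : 0 < Num.sqrt del by rewrite sqrtr_gt0.
apply: le_trans (energy_complex_contraction gamG (Phi \o k) sdel0 _) _.
  move=> t; rewrite sqr_sqrtr; last exact: ltW.
  apply: (@le_trans _ _ (\sum_(l < J) ((\sum_(n < N) sqmod (coef (tail m f) n l)) *
      \sum_(n < N) t n ^+ 2))).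
    apply: ler_sum => l _; rewrite /sqmod /=. rewrite big_split /= mulrDl.
    apply: lerD; exact: (@sum_cauchy_schwarz _ N t (fun n => _ (coef (tail m f) n l))).
  rewrite -mulr_suml exchange_big /= ler_wpM2r//.
    by apply: sumr_ge0 => n _; exact: sqr_ge0.
  apply: ltW; apply: le_lt_trans (N0H N).
  rewrite -(big_mkord xpredT (fun n => \sum_(l < J) sqmod (coef (tail m f) n l))).
  have zero n : (n < m)%N -> \sum_(l < J) sqmod (coef (tail m f) n l) = 0.
    move=> nm; rewrite big1// => l _.
    by rewrite /coef /tail nm (sip0l dotP) /sqmod /= expr0n addr0.
  have le_b n : \sum_(l < J) sqmod (coef (tail m f) n l) <= b n.
    have [nm|mn] := ltnP n m; first by rewrite zero.
    by rewrite /coef /tail ltnNge mn.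
  have [NN0|N0N] := leqP N N0.
    rewrite [leRHS]big_geq// big1_seq// => n; rewrite mem_index_iota /= => nN.
    by rewrite zero// (leq_trans nN)// (leq_trans NN0).
  rewrite (big_cat_nat (leq0n N0) (ltnW N0N))/= big1_seq ?add0r.
    by apply: ler_sum => n _.
  move=> n; rewrite mem_index_iota /= => nN.
  by rewrite zero// (leq_trans nN).
rewrite sqr_sqrtr; last exact: ltW.
apply: (@le_trans _ _ ((4 * del)%:E * (2 * S)%:E)%E).
  apply: lee_wpmul2l; first by rewrite lee_fin mulr_ge0// ltW.
  by rewrite EFinM -SE; exact/(energy_le_sum gamG)/gauss_sumP.
rewrite -EFinM lee_fin (_ : 4 * del * (2 * S) = del * (8 * S)); last by ring.
by rewrite /del mulrAC ler_pdivrMr// ler_wpM2l ?(ltW e0)// lerDl.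
Qed.

(** For rows n >= m, split the coordinates at J. The columns l >= J act on the tail
    of the series of Phi k, small by the choice of J; then m is chosen so large
    that the columns l < J are negligible. *)
Theorem gauss_cvg_ideal c f : 0 < c -> real_bessel c f -> gauss_cvg gam (Phi \o f).
Proof.
move=> c0 bf; apply: gauss_cvg_cauchy => // [n|e e0].
  apply: le_lt_trans (energy_ideal n c0 bf) _.
  by rewrite lte_mul_pinfty// lee_fin; apply: mulr_ge0 => //; exact: sqr_ge0.
pose e1 := e / (16 * c ^+ 2).
have e10 : 0 < e1 by rewrite divr_gt0// mulr_gt0// exprn_gt0.
have [J JH] := energy_tail_small gamG (gauss_sumP kC) e10.
have e40 : 0 < e / 4 by rewrite divr_gt0.
have [N0 N0H] := energy_hs_tail J c0 bf e40.
exists N0 => m N /andP[N0m mN].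
have -> : energy N (tail m (Phi \o f)) = energy N (Phi \o tail m f).
  by apply: eq_energy => n _ /=; rewrite /tail; case: ifP.
apply: energy_fatou; exists J => M JM.
have btail := real_bessel_tail m c0 bf.
rewrite (@eq_energy _ _ _ _ _ _ N _ (fun n => proj (tail m f) J n +
   \sum_(l < M) coef (tail m f) n l *: tail J (Phi \o k) l)); last first.
  move=> n _; rewrite /proj.
  rewrite -!(big_mkord xpredT (fun l => coef (tail m f) n l *: Phi (k l))).
  rewrite -!(big_mkord xpredT (fun l => coef (tail m f) n l *: tail J (Phi \o k) l)).
  rewrite (big_cat_nat (leq0n J) JM)/=; congr (_ + _).
  rewrite [RHS](big_cat_nat (leq0n J) JM)/= [X in _ = X + _]big1_seq ?add0r.
    apply: eq_big_nat => l /andP[Jl _].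
    by rewrite /tail ltnNge Jl.
  by move=> l; rewrite mem_index_iota /= => lJ; rewrite /tail lJ scaler0.
apply: le_trans (energyD _ _ _ _) _.
have -> : (e%:E = 2%:E * (e / 4)%:E + 2%:E * ((4 * c ^+ 2)%:E * e1%:E))%E.
  by rewrite -!EFinM -EFinD /e1; congr (_%:E); field; rewrite gt_eqF.
apply: leeD; apply: lee_wpmul2l => //; first exact: N0H.
apply: le_trans (energy_complex_contraction gamG _ c0 _) _.
  by move=> t; exact: coef_contraction.
apply: lee_wpmul2l; first by rewrite lee_fin mulr_ge0// sqr_ge0.
exact: JH.
Qed.

Theorem gauss_sqnorm_ideal c f : 0 < c -> real_bessel c f ->
  (gauss_sqnorm gam (Phi \o f) <= (16 * c ^+ 2)%:E * gauss_sqnorm gam (Phi \o k))%E.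
Proof.
move=> c0 bf; rewrite (_ : 16 * c ^+ 2 = 2 * (8 * c ^+ 2)); last by ring.
rewrite EFinM -muleA; apply: gauss_sqnorm_le => //.
  exact: gauss_cvg_ideal bf.
by move=> n; exact: energy_ideal.
Qed.

End ideal_property.

(** * Sectors and exponential tensors *)

Section sector_geometry.
Context {R : realType}.
Implicit Types lambda : R[i].

Lemma Re_norm_sq (z : R[i]) : complex.Re `|z| ^+ 2 = sqmod z.
Proof. by rewrite normc_def /= sqr_sqrtr// sqmod_ge0. Qed.

Lemma sqmod_mul (z w : R[i]) : sqmod (z * w) = sqmod z * sqmod w.
Proof. by case: z w => [a b] [p q]; rewrite /sqmod /=; ring. Qed.

Lemma sqmod_real (r : R) : sqmod r%:C = r ^+ 2.
Proof. by rewrite /sqmod /= expr0n addr0. Qed.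

Lemma sqmod_sqrtc lambda : sqmod (sqrtc lambda) = complex.Re `|lambda|.
Proof.
have z0 (z : R[i]) : 0 <= complex.Re `|z| by rewrite normc_def /= sqrtr_ge0.
apply: (@pexpIrn R 2) => //; rewrite ?nnegrE ?sqmod_ge0//.
by rewrite Re_norm_sq expr2 -sqmod_mul -expr2 sqr_sqrtc.
Qed.

Lemma sqmod_expC (z : R[i]) : sqmod (expC z) = expR (complex.Re z) ^+ 2.
Proof. by rewrite /sqmod /= !exprMn -mulrDr cos2Dsin2 mulr1. Qed.

(** Since |Arg lambda| = acos (Re lambda / |lambda|), and cos decreases on [0, pi]. *)
Lemma sector_Re theta lambda : 0 < theta < pi / 2 -> sector theta lambda ->
  0 < complex.Re lambda /\ cos theta * complex.Re `|lambda| <= complex.Re lambda.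
Proof.
move=> /andP[t0 tpi] [l0 argl].
have r0 : 0 < complex.Re `|lambda|.
  by rewrite -ltcR ReM_norm normr_gt0.
have r2 := Re_norm_sq lambda.
set r := complex.Re `|lambda| in r0 r2 *.
have c0 : 0 < cos theta.
  by apply: cos_gt0_pihalf; rewrite tpi andbT (lt_trans _ t0)// oppr_lt0 divr_gt0// pi_gt0.
pose q := complex.Re lambda / r.
have q11 : -1 <= q <= 1.
  rewrite -ler_norml -(@ler_pXn2r _ 2)// ?nnegrE// expr1n real_normK ?num_real//.
  rewrite expr_div_n ler_pdivrMr ?exprn_gt0// mul1r r2 /sqmod lerDl.
  exact: sqr_ge0.
have [/andP[a0 api] cosa] := acos_def q11.
have at' : acos q < theta.
  apply: le_lt_trans argl; rewrite /Carg -/r -/q.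
  by case: ifP => _; rewrite ?normrN ger0_norm.
have pi2 : theta <= pi.
  by rewrite (le_trans (ltW tpi))// ler_pdivrMr// ler_peMr ?pi_ge0// ler1n.
have cq : cos theta <= q.
  rewrite -cosa; apply: ltW.
  by rewrite ltr_cos// in_itv/= ?a0 ?api// (ltW t0).
have key : cos theta * r <= complex.Re lambda.
  by rewrite -ler_pdivlMr.
by split=> //; apply: lt_le_trans key; exact: mulr_gt0.
Qed.

End sector_geometry.

Section exponential_tensors.
Context {R : realType} {H : normedModType R[i]}.
Local Notation mu := (@lebesgue_measure R).
Implicit Types (lambda : R[i]) (h : H).

(** Compare with the density of the exponential law of rate a. *)
Lemma integral_exp (a : R) : 0 < a ->
  (\int[mu]_(t in `[0%R, +oo[) (expR (- (a * t)))%:E <= (a^-1)%:E)%E.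
Proof.
move=> a0.
have mpdf : measurable_fun setT (EFin \o exponential_pdf a).
  by apply/measurable_EFinP; exact: measurable_exponential_pdf.
have pdf0 t : (0 <= (exponential_pdf a t)%:E)%E.
  by rewrite lee_fin exponential_pdf_ge0// ltW.
rewrite (_ : integral _ _ _ = (\int[mu]_(t in `[0%R, +oo[)
    (a^-1%:E * (exponential_pdf a t)%:E))%E); last first.
  apply: eq_integral => t; rewrite inE /= in_itv /= andbT => t0.
  by rewrite exponential_pdfE// -EFinM mulNr mulKf// gt_eqF.
rewrite ge0_integralZl_EFin//; last 2 first.
- exact: measurable_funTS.
- by rewrite invr_ge0 ltW.
rewrite -[leRHS]mule1; apply: lee_wpmul2l; first by rewrite lee_fin invr_ge0 ltW.
rewrite -(integral_exponential_pdf a0).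
exact: ge0_subset_integral.
Qed.

Lemma exp_tensor_linear lambda (a : R[i]) h h' : 0 < complex.Re lambda ->
  exp_tensor lambda (a *: h + h') =
  a *: exp_tensor lambda h + exp_tensor lambda h'.
Proof.
move=> l0; apply: val_inj => /=; rewrite exp_tensorE//.
apply/funext => t; rewrite /exp_fun scalerDr scalerA mulrC -scalerA.
by congr (_ *: _ + _); rewrite -[LHS]/(exp_fun lambda _ t) -exp_tensorE.
Qed.

Lemma sum_exp_tensorE n (a lambda : nat -> R[i]) (h : nat -> H) (s : R) :
  (forall k, 0 < complex.Re (lambda k)) ->
  (\sum_(k < n) a k *: exp_tensor (lambda k) (h k) : L2Rplus H) s =
  \sum_(k < n) (a k * expC (- (lambda k * s%:C))) *: h k.
Proof.
move=> l0; elim: n => [|n IHn]; first by rewrite !big_ord0.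
rewrite !big_ord_recr /= -IHn; congr (_ + _).
by rewrite -scalerA; congr (_ *: _); rewrite -[RHS]/(exp_fun (lambda n) _ s) -exp_tensorE.
Qed.

Variable dot : {dot H for Num.conj}.
Hypothesis dotE : forall x : H, `|x| ^+ 2 = dot x x.

(** The identity on the h k holds at each time s, with coefficients depending on s;
    it is then integrated in s. *)
Lemma sqnorm_exp_tensors n (a lambda : nat -> R[i]) (h : nat -> H) :
  (forall k, 0 < complex.Re (lambda k)) ->
  (forall b : nat -> R[i], rnorm (\sum_(k < n) b k *: h k) ^+ 2 =
     \sum_(k < n) sqmod (b k) * rnorm (h k) ^+ 2) ->
  forall f : L2Rplus H, f = \sum_(k < n) a k *: exp_tensor (lambda k) (h k) ->
  complex.Re (L2dot dot f f) <=
  \sum_(k < n) sqmod (a k) * rnorm (h k) ^+ 2 / (2 * complex.Re (lambda k)).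
Proof.
move=> l0 oh f fE; rewrite -lee_fin (Re_L2dot dotE) /int_sqnorm.
pose w k := sqmod (a k) * rnorm (h k) ^+ 2.
have w0 k : 0 <= w k by rewrite mulr_ge0 ?sqmod_ge0 ?sqr_ge0.
pose g (k : nat) (s : measurableTypeR R) : \bar R := (w k * expR (- (2 * complex.Re (lambda k) * s)))%:E.
have mexp k : measurable_fun setT (fun s : measurableTypeR R =>
    expR (- (2 * complex.Re (lambda k) * s))).
  by apply: (measurableT_comp (@measurable_expR R));
    apply: measurable_funN; exact: measurable_funM.
have mg k : measurable_fun (`[0%R, +oo[ : set (measurableTypeR R)) (g k).
  apply: measurable_funTS; apply/measurable_EFinP; apply: measurable_funM => //; exact: mexp.
have g0 k s : (0 <= g k s)%E by rewrite lee_fin mulr_ge0 ?w0 ?expR_ge0.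
rewrite (_ : integral _ _ _ =
    (\int[mu]_(s in `[0%R, +oo[) (\sum_(k < n) g k s)%R)%E); last first.
  apply: eq_integral => s _; rewrite fE sum_exp_tensorE//.
  rewrite (oh (fun k => a k * expC (- (lambda k * s%:C)))) -sumEFin.
  apply: eq_bigr => k _; rewrite /g sqmod_mul sqmod_expC mulrAC; congr (_ * _)%:E.
  rewrite expr2 -expRD; congr expR.
  by case: (lambda k) => p q /=; ring.
rewrite ge0_integral_sum// -sumEFin; apply: lee_sum => k _.
have a0 : 0 < 2 * complex.Re (lambda k) by rewrite mulr_gt0.
rewrite /g; under eq_integral do rewrite EFinM.
rewrite ge0_integralZl_EFin ?w0//.
- rewrite [leRHS]EFinM; apply: lee_wpmul2l; first by rewrite lee_fin w0.
  exact: integral_exp.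
- apply: measurable_funTS; apply/measurable_EFinP; exact: mexp.
Qed.

Lemma rnorm_sq_orthonormal n (h : nat -> H) (b : nat -> R[i]) :
  orthonormal_seq dot h ->
  rnorm (\sum_(k < n) b k *: h k) ^+ 2 = \sum_(k < n) sqmod (b k) * rnorm (h k) ^+ 2.
Proof.
move=> oh; rewrite -(Re_dot_rnorm dotE).
rewrite (orthonormal_pythagoras (dot_semi_inner_product dot))//.
by apply: eq_bigr => k _; rewrite -(Re_dot_rnorm dotE) oh eqxx mulr1.
Qed.

End exponential_tensors.

(** * The Laplace transform *)

Section laplace_families.
Context d (Omega : measurableType d) (R : realType) (P : probability Omega R).
Variable gam : nat -> {RV P >-> R}.
Hypothesis gamG : gaussian_sequence gam.
Context {H : normedModType R[i]} (dot : {dot H for Num.conj}).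
Hypothesis dotE : forall x : H, `|x| ^+ 2 = dot x x.
Context {E : completeNormedModType R[i]}.
Variable Phi : L2Rplus H -> E.
Variable theta : R.
Hypothesis theta_bnd : 0 < theta < pi / 2.
Local Notation L2P := (L2dot_semi_inner_product
  (@lebesgue_measure R) (measurable_itv `[0 : R, +oo[) dotE).

Let cos_gt0 : 0 < cos theta.
Proof.
have /andP[t0 tpi] := theta_bnd.
by apply: cos_gt0_pihalf; rewrite tpi andbT (lt_trans _ t0)// oppr_lt0 divr_gt0// pi_gt0.
Qed.

Let c := Num.sqrt (2 * cos theta)^-1.

Let c_gt0 : 0 < c.
Proof. by rewrite sqrtr_gt0 invr_gt0 mulr_gt0. Qed.

Let c_sq : c ^+ 2 = (2 * cos theta)^-1.
Proof. by rewrite sqr_sqrtr// invr_ge0 mulr_ge0 ?ltW. Qed.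

(** The square root of lambda normalizes: |lambda| / (2 Re lambda) <= c ^ 2. *)
Lemma real_bessel_laplace (lambda : nat -> R[i]) (h : nat -> H) :
  (forall k, sector theta (lambda k)) -> orthonormal_seq dot h ->
  real_bessel (L2dot dot) c
    (fun n => sqrtc (lambda n) *: exp_tensor (lambda n) (h n) : L2Rplus H).
Proof.
move=> sl oh N t.
have l0 k : 0 < complex.Re (lambda k) := (sector_Re theta_bnd (sl k)).1.
have lc k := (sector_Re theta_bnd (sl k)).2.
have ohE b := rnorm_sq_orthonormal dotE N b oh.
apply: le_trans (sqnorm_exp_tensors (a := fun k => (t k)%:C * sqrtc (lambda k))
  dotE l0 ohE _) _.
  by apply: eq_bigr => k _; rewrite scalerA.
rewrite c_sq mulr_sumr; apply: ler_sum => k _.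
rewrite sqmod_mul sqmod_real sqmod_sqrtc -(Re_dot_rnorm dotE) oh eqxx mulr1.
rewrite ler_pdivrMr ?mulr_gt0// mulrC -mulrA [leRHS]mulrC.
rewrite -ler_pdivrMr ?invr_gt0 ?mulr_gt0// invrK.
rewrite [leLHS](_ : _ = t k ^+ 2 * (2 * (cos theta * complex.Re `|lambda k|))); last by ring.
rewrite [leRHS](_ : _ = t k ^+ 2 * (2 * complex.Re (lambda k))); last by ring.
by apply: ler_wpM2l; rewrite ?sqr_ge0// ler_pM2l.
Qed.

(** Boundedness comes from the case of a single exponential tensor. *)
Lemma laplace_bounded lambda : bounded_linear (L2dot dot) Phi ->
  sector theta lambda ->
  bounded_linear dot (fun h : H => sqrtc lambda *: laplace Phi lambda h).
Proof.
move=> [linPhi [B PhiB]] /(sector_Re theta_bnd)[l0 _].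
split.
  move=> a x y; rewrite /laplace exp_tensor_linear// linPhi scalerDr !scalerA.
  by rewrite mulrC.
pose C := Num.sqrt (2 * complex.Re lambda)^-1.
exists (complex.Re `|sqrtc lambda| * (`|B| * C)) => x.
have r0 : 0 <= complex.Re `|sqrtc lambda| by rewrite normc_def /= sqrtr_ge0.
rewrite rnormZ -mulrA; apply: ler_wpM2l => //.
apply: le_trans (PhiB _) _; rewrite -mulrA.
apply: (le_trans (ler_wpM2r _ (ler_norm B))); first exact: sqrtr_ge0.
apply: ler_wpM2l; first exact: normr_ge0.
rewrite /C (dot_norm_rnorm dotE) -[rnorm x]ger0_norm ?rnorm_ge0// -sqrtr_sqr.
rewrite -sqrtrM ?invr_ge0 ?mulr_ge0 ?(ltW l0)// /dot_norm; apply: ler_wsqrtr.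
have xE b : rnorm (\sum_(k < 1) b k *: x) ^+ 2 =
    \sum_(k < 1) sqmod (b k) * rnorm x ^+ 2.
  by rewrite !big_ord1 rnormZ exprMn Re_norm_sq.
have := sqnorm_exp_tensors (a := fun=> 1) (lambda := fun=> lambda) (h := fun=> x)
  dotE (fun=> l0) xE.
move=> /(_ (exp_tensor lambda x)); rewrite !big_ord1 scale1r => /(_ erefl).
by rewrite /sqmod /= expr1n expr0n addr0 mul1r mulrC.
Qed.

(** The constant 3 is admissible because 16 c ^ 2 = 8 / cos theta is at most
    9 / cos theta ^ 2. *)
Lemma laplace_families (k : nat -> L2Rplus H) :
  bounded_linear (L2dot dot) Phi -> orthonormal_basis (L2dot dot) k ->
  gauss_cvg gam (Phi \o k) ->
  [/\ (exists h, orthonormal_basis dot h) ->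
        laplace_family Phi theta `<=` gamma_radonifying gam dot,
      unif_gamma_radonifying gam dot (laplace_family Phi theta) &
      (unif_gamma_norm gam dot (laplace_family Phi theta) <=
         (3 / cos theta)%:E * gamma_norm gam k Phi)%E].
Proof.
move=> PhiB kB kC.
have repr (h : nat -> H) (S : nat -> H -> E) : orthonormal_basis dot h ->
    (forall n, laplace_family Phi theta (S n)) ->
    exists2 f : nat -> L2Rplus H, real_bessel (L2dot dot) c f &
      (fun n => S n (h n)) = Phi \o f.
  move=> hB SL.
  have /choice[lambda lamP] n : exists lambda, sector theta lambda /\
      S n = (fun h => sqrtc lambda *: laplace Phi lambda h).
    by have [l sl ->] := SL n; exists l.
  exists (fun n => sqrtc (lambda n) *: exp_tensor (lambda n) (h n) : L2Rplus H).
    by apply: real_bessel_laplace; [move=> n; exact: (lamP n).1|exact: hB.1].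
  apply/funext => n /=; rewrite (lamP n).2 /laplace.
  have Phi0 : Phi 0 = 0.
    have := PhiB.1 1 0 0; rewrite !scale1r addr0 => Phi00.
    by apply: (addrI (Phi 0)); rewrite addr0 -Phi00.
  by rewrite -[sqrtc _ *: exp_tensor _ _]addr0 PhiB.1 Phi0 addr0.
have cvgS (h : nat -> H) (S : nat -> H -> E) : orthonormal_basis dot h ->
    (forall n, laplace_family Phi theta (S n)) -> gauss_cvg gam (fun n => S n (h n)).
  move=> hB SL; have [f bf ->] := repr h S hB SL.
  exact: (gauss_cvg_ideal gamG L2P PhiB kB kC c_gt0 bf).
have bndS S : laplace_family Phi theta S -> bounded_linear dot S.
  by move=> [lambda sl ->]; exact: laplace_bounded.
split.
- move=> [h hB] S SL; split; first exact: bndS.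
  by exists h; split=> //; apply: (cvgS h (fun=> S)).
- by split=> // h S; exact: cvgS.
have G0 : (0 <= gauss_sqnorm gam (Phi \o k))%E by exact: int_sqnorm_ge0.
rewrite /unif_gamma_norm /gamma_norm.
have t0 : 0 <= 3 / cos theta by rewrite divr_ge0// ltW.
have -> : (3 / cos theta)%:E = sqrte (((3 / cos theta) ^+ 2)%:E) :> \bar R.
  by rewrite /= sqrtr_sqr ger0_norm.
rewrite -sqrteM ?lee_fin ?sqr_ge0//.
rewrite lee_sqrt; last by rewrite mule_ge0// lee_fin sqr_ge0.
apply: ge_ereal_sup => _ [h [S [hB SL ->]]].
have [f bf ->] := repr h S hB SL.
apply: le_trans (gauss_sqnorm_ideal gamG L2P PhiB kB kC c_gt0 bf) _.
apply: lee_wpmul2r => //; rewrite lee_fin c_sq.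
rewrite (_ : 16 * (2 * cos theta)^-1 = (8 * cos theta) / cos theta ^+ 2); last first.
  by field; rewrite gt_eqF.
rewrite expr_div_n ler_wpM2r ?invr_ge0 ?sqr_ge0//.
by have := cos_le1 theta; lra.
Qed.

End laplace_families.

Theorem theorem4p8 (R : realType) :
  exists C' : R,
  forall (d : measure_display) (Omega : measurableType d)
    (P : probability Omega R) (gam : nat -> {RV P >-> R}),
    gaussian_sequence gam ->
  forall (H : completeNormedModType R[i]) (dot : {dot H for Num.conj}),
    (forall x : H, `|x| ^+ 2 = dot x x) ->
    separable H -> infinite_dimensional H ->
  forall (E : completeNormedModType R[i]) (Phi : L2Rplus H -> E),
    gamma_radonifying gam (L2dot dot) Phi ->
  forall theta : R, 0 < theta < pi / 2 ->
    [/\ laplace_family Phi theta `<=` gamma_radonifying gam dot,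
        unif_gamma_radonifying gam dot (laplace_family Phi theta) &
        forall k : nat -> L2Rplus H, orthonormal_basis (L2dot dot) k ->
          (unif_gamma_norm gam dot (laplace_family Phi theta) <=
           (C' / cos theta)%:E * gamma_norm gam k Phi)%E].
Proof.
exists 3 => d Omega P gam gamG H dot dotE sepH infH E Phi [PhiB [k0 [k0B k0C]]].
move=> theta theta_bnd.
have [rad unif _] := laplace_families gamG dotE theta_bnd PhiB k0B k0C.
split=> //.
  exact/rad/(orthonormal_basis_exists dotE infH sepH).
move=> k kB.
have L2P := L2dot_semi_inner_product
  (@lebesgue_measure R) (measurable_itv `[0 : R, +oo[) dotE.
(* The series of Phi k converges for every basis k, not only for k0. *)
have kbessel : real_bessel (L2dot dot) 1 k.
  move=> N t; rewrite (orthonormal_pythagoras L2P _ (fun n => (t n)%:C) kB.1).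
  rewrite expr1n mul1r; apply: ler_sum => n _; by rewrite sqmod_real.
have kC := gauss_cvg_ideal gamG L2P PhiB k0B k0C ltr01 kbessel.
by have [_ _] := laplace_families gamG dotE theta_bnd PhiB kB kC.
Qed.
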